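(* Let $X$ be a Hausdorff space and $L:X\times X\to[1,\infty)$ a continuous log-conditional kernel. The kernel $H_{L}:X\times X\to\mathbb{R}$, $H_{L}(x,y):=L(x,y)^{-1}$, is integrally strictly positive definite (ISPD) if and only if $L$ is metrizable.
   Context: A kernel $\gamma:X\times X\to\mathbb{R}$ is conditionally negative definite if $\gamma(x,y)=\gamma(y,x)$ and $\sum_{\mu,\nu=1}^{n}c_{\mu}c_{\nu}\gamma(x_{\mu},x_{\nu})\le 0$ for all finitely many distinct points $x_{1},\dots,x_{n}$ and $c_{1},\dots,c_{n}\in\mathbb{R}$ with $\sum_{\mu}c_{\mu}=0$. Such a $\gamma$ is metrizable if $2\gamma(x,y)>\gamma(x,x)+\gamma(y,y)$ for all $x\neq y$ in $X$. A symmetric kernel $L:X\times X\to[1,\infty)$ is log-conditional if $\log L(x,y)$ is conditionally negative definite; a log-conditional kernel $L$ is metrizable if $\log L$ is metrizable. A kernel $K:X\times X\to\mathbb{C}$ is positive definite if $\sum_{\mu,\nu=1}^{n}c_{\mu}\overline{c_{\nu}}K(x_{\mu},x_{\nu})\ge 0$ for all finitely many distinct points $x_{\mu}\in X$ and scalars $c_{\mu}\in\mathbb{C}$. Its reproducing kernel Hilbert space $\mathcal{H}_{K}$ is the Hilbert space of functions $F:X\to\mathbb{C}$ that contains $K_{y}:=K(\cdot,y)$ for every $y\in X$, satisfies $\langle F,K_{y}\rangle_{\mathcal{H}_{K}}=F(y)$, and in which $\mathrm{span}\{K_{y}:y\in X\}$ is dense. $\mathcal{M}(X)$ denotes the finite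 complex-valued Radon measures on $X$: complex Borel measures $\lambda$ with $|\lambda|$ finite and, for every Borel $E$, $|\lambda|(E)=\sup\{|\lambda|(K):K\subset E\text{ compact}\}=\inf\{|\lambda|(U):U\supset E\text{ open}\}$. A bounded positive definite kernel $K$ on a Hausdorff space $X$ with $\mathcal{H}_{K}\subset C(X)$ is ISPD if the only $\lambda\in\mathcal{M}(X)$ with $\int_{X}\int_{X}K(x,y)\,d\lambda(x)\,d\overline{\lambda}(y)=0$ is the zero measure. *)

(* Defs.v *)
From HB Require Import structures.
From mathcomp Require Import all_boot all_order all_algebra.
From mathcomp Require Import complex.
From mathcomp Require Import all_classical all_reals all_analysis.

Set Implicit Arguments.
Unset Strict Implicit.
Unset Printing Implicit Defensive.

Import Order.TTheory GRing.Theory Num.Theory.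
Import numFieldNormedType.Exports.
Import ComplexField.Normc.

Local Open Scope classical_set_scope.
Local Open Scope complex_scope.
Local Open Scope ring_scope.

(** * Conditionally negative definite and log-conditional kernels *)

Definition cond_neg_def (R : realType) (X : Type) (g : X -> X -> R) : Prop :=
  (forall x y, g x y = g y x) /\
  forall (n : nat) (x : 'I_n -> X) (c : 'I_n -> R),
    injective x -> \sum_i c i = 0 ->
    \sum_i \sum_j c i * c j * g (x i) (x j) <= 0.

Definition metrizable (R : realType) (X : Type) (g : X -> X -> R) : Prop :=
  forall x y, x <> y -> g x x + g y y < 2 * g x y.

Definition log_kernel (R : realType) (X : Type) (L : X -> X -> R) :
  X -> X -> R := fun x y => ln (L x y).

Definition log_conditional (R : realType) (X : Type) (L : X -> X -> R) : Prop :=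
  [/\ forall x y, 1 <= L x y,
      forall x y, L x y = L y x
    & cond_neg_def (log_kernel L)].

Definition log_metrizable (R : realType) (X : Type) (L : X -> X -> R) : Prop :=
  metrizable (log_kernel L).

Definition inverse_kernel (R : realType) (X : Type) (L : X -> X -> R) :
  X -> X -> R := fun x y => (L x y)^-1.

(** * Positive definite kernels and their reproducing kernel Hilbert spaces *)

(* The order of [R[i]] makes [0 <= z] mean that z is real and nonnegative. *)
Definition pos_def (R : realType) (X : Type) (K : X -> X -> R[i]) : Prop :=
  forall (n : nat) (x : 'I_n -> X) (c : 'I_n -> R[i]),
    injective x -> 0 <= \sum_i \sum_j c i * (c j)^* * K (x i) (x j).

Definition bounded_kernel (R : realType) (X : Type) (K : X -> X -> R[i]) :
    Prop :=
  exists M : R, forall x y, normc (K x y) <= M.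

Definition ip_norm (R : realType) (X : Type)
    (ip : (X -> R[i]) -> (X -> R[i]) -> R[i]) (F : X -> R[i]) : R :=
  Num.sqrt (complex.Re (ip F F)).

(* [rkhs_fun] is the set of functions forming the space; [rkhs_ip] is only
   meaningful on that set. *)
Record rkhs (R : realType) (X : Type) (K : X -> X -> R[i]) := Rkhs {
  rkhs_fun : set (X -> R[i]);
  rkhs_ip : (X -> R[i]) -> (X -> R[i]) -> R[i];
  rkhs_zero : rkhs_fun 0;
  rkhs_lincomb : forall (a : R[i]) F G,
    rkhs_fun F -> rkhs_fun G -> rkhs_fun (a *: F + G);
  rkhs_ip_linear : forall (a : R[i]) F G H,
    rkhs_fun F -> rkhs_fun G -> rkhs_fun H ->
    rkhs_ip (a *: F + G) H = a * rkhs_ip F H + rkhs_ip G H;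
  rkhs_ip_conj : forall F G, rkhs_fun F -> rkhs_fun G ->
    rkhs_ip G F = (rkhs_ip F G)^*;
  rkhs_ip_ge0 : forall F, rkhs_fun F -> 0 <= rkhs_ip F F;
  rkhs_ip_eq0 : forall F, rkhs_fun F -> rkhs_ip F F = 0 -> F = 0;
  rkhs_complete : forall u : nat -> X -> R[i],
    (forall n, rkhs_fun (u n)) ->
    (forall e : R, 0 < e -> exists N : nat, forall m n : nat,
      (N <= m)%N -> (N <= n)%N -> ip_norm rkhs_ip (u m - u n) < e) ->
    exists2 F, rkhs_fun F &
      forall e : R, 0 < e -> exists N : nat, forall n : nat,
        (N <= n)%N -> ip_norm rkhs_ip (u n - F) < e;
  rkhs_kernel : forall y, rkhs_fun (K^~ y);
  rkhs_reproducing : forall F y, rkhs_fun F -> rkhs_ip F (K^~ y) = F y;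
  rkhs_dense : forall F (e : R), rkhs_fun F -> 0 < e ->
    exists (n : nat) (y : 'I_n -> X) (a : 'I_n -> R[i]),
      ip_norm rkhs_ip (F - \sum_i a i *: (K^~ (y i))) < e
}.

(* By the Moore-Aronszajn theorem a positive definite kernel has exactly one
   RKHS, so for such kernels the quantifier ranges over that single space.
   [R[i]^o] carries the topology of the modulus. *)
Definition rkhs_continuous (R : realType) (X : topologicalType)
    (K : X -> X -> R[i]) : Prop :=
  forall (H : rkhs K) (F : X -> R[i]),
    rkhs_fun H F -> continuous (F : X -> R[i]^o).

(** * Complex measures *)

(* A complex measure is given by its real and imaginary parts, which are finite
   signed measures. *)
Record complex_measure (d : measure_display) (T : measurableType d)
    (R : realType) := ComplexMeasure {
  cm_re : {charge set T -> \bar R};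
  cm_im : {charge set T -> \bar R}
}.

Definition cm_val (d : measure_display) (T : measurableType d) (R : realType)
    (l : complex_measure T R) (A : set T) : R[i] :=
  fine (cm_re l A) +i* fine (cm_im l A).

Definition cm_conj (d : measure_display) (T : measurableType d) (R : realType)
    (l : complex_measure T R) : complex_measure T R :=
  ComplexMeasure (cm_re l) (copp (cm_im l)).

(* Charges are total functions on [set T]; only their values on measurable sets
   are significant. *)
Definition cm_is_zero (d : measure_display) (T : measurableType d)
    (R : realType) (l : complex_measure T R) : Prop :=
  forall A : set T, measurable A -> cm_val l A = 0.

Definition cm_variation (d : measure_display) (T : measurableType d)
    (R : realType) (l : complex_measure T R) (E : set T) : \bar R :=
  ereal_sup
    [set (\sum_(0 <= n <oo) (normc (cm_val l (A n)))%:E)%E | A in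
      [set A : nat -> set T | [/\ forall n, measurable (A n),
                                  trivIset setT A & \bigcup_n A n = E]]].

(* The Jordan decomposition, hence the integral, does not depend on the Hahn
   decomposition that is chosen. *)
Definition charge_integral (d : measure_display) (T : measurableType d)
    (R : realType) (nu : {charge set T -> \bar R}) (f : T -> R) : R :=
  let nuPN := projT2 (cid (projT2 (cid (Hahn_decomposition nu)))) in
  \int[jordan_pos nuPN]_x f x - \int[jordan_neg nuPN]_x f x.

Definition cm_integral (d : measure_display) (T : measurableType d)
    (R : realType) (l : complex_measure T R) (f : T -> R[i]) : R[i] :=
  (charge_integral (cm_re l) (fun x => complex.Re (f x))
   - charge_integral (cm_im l) (fun x => complex.Im (f x)))
  +i* (charge_integral (cm_re l) (fun x => complex.Im (f x))
       + charge_integral (cm_im l) (fun x => complex.Re (f x))).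

(** * Radon measures and ISPD kernels *)

(* The library requires measurable types to be pointed.  The base point plays
   no role in the notions below. *)
Definition pointed_at (X : Type) (x0 : X) : Type := X.

HB.instance Definition _ (X : choiceType) (x0 : X) :=
  Choice.on (pointed_at x0).
HB.instance Definition _ (X : choiceType) (x0 : X) :=
  isPointed.Build (pointed_at x0) x0.

Definition borel (X : topologicalType) (x0 : X) :=
  g_sigma_algebraType (@open X : set (set (pointed_at x0))).

HB.instance Definition _ (X : topologicalType) (x0 : X) :=
  Measurable.on (borel x0).

Definition radon (R : realType) (X : topologicalType) (x0 : X)
    (l : complex_measure (borel x0) R) : Prop :=
  (cm_variation l setT < +oo)%E /\
  forall E : set (borel x0), measurable E ->
    cm_variation l E = ereal_sup
      [set cm_variation l C | C in [set C : set X | compact C /\ C `<=` E]]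
    /\ cm_variation l E = ereal_inf
      [set cm_variation l U | U in [set U : set X | open U /\ E `<=` U]].

(* On an empty space the last clause holds vacuously, as it should: the only
   measure there is zero. *)
Definition ispd (R : realType) (X : topologicalType) (K : X -> X -> R[i]) :
    Prop :=
  [/\ bounded_kernel K, pos_def K, rkhs_continuous K
    & forall (x0 : X) (l : complex_measure (borel x0) R), radon l ->
        cm_integral (cm_conj l) (fun y => cm_integral l (K^~ y)) = 0 ->
        cm_is_zero l].

(* Main.v *)
(** Write g = log L and fix a base point x0.  The kernel
    k(x,y) = 1 + g(x,x0) + g(x0,y) - g(x,y) - g(x0,x0) is positive definite and
    1/L = C w(x) w(y) exp(k(x,y)) with w = 1/L(.,x0) and a constant C > 0.
    If f lies in the RKHS of k, then comparing the power series of exp(k) and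
    of cos, with Schur's product theorem, shows that w cos(f) lies in the RKHS
    of 1/L.  A measure of zero energy (its real and imaginary parts may be
    treated separately) annihilates that RKHS, so it annihilates w cos(f).
    The span of the functions cos(f) is an algebra, since these f form a vector
    space containing the constants, and it separates points exactly when L is
    metrizable.  As in the Stone-Weierstrass theorem its uniform closure is a
    lattice; it contains functions bounded by 1 that approximate the sign of a
    tight signed measure, whence w times the measure, and so the measure itself,
    vanishes.
    Conversely, if metrizability fails at x <> y, the 2 x 2 matrix of 1/L at
    these points is singular and some combination of two Dirac masses has zero
    energy. *)

Require Import Defs.
From mathcomp Require Import all_boot all_order all_algebra.
From mathcomp Require Import complex.
From mathcomp Require Import all_classical all_reals all_analysis.
From mathcomp Require Import ring lra measurable_realfun.

Set Implicit Arguments.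
Unset Strict Implicit.
Unset Printing Implicit Defensive.

Import Order.TTheory GRing.Theory Num.Theory.
Import numFieldNormedType.Exports.

Local Open Scope classical_set_scope.
Local Open Scope complex_scope.
Local Open Scope ring_scope.

(** * Positive definite matrices and dominated functions *)

(** The obstacle is that functions in the RKHS of k are in general unbounded and X need not be
    locally compact, so polynomials in f are no substitute for the cosines. The function w cos(f) is
    bounded, the Taylor coefficients of cos are at most those of exp in absolute value, and the
    product-to-sum formula closes the span of cosines under products without sines, whose role is
    taken by phase shifts along the constants. No Hilbert space is built for k or for 1/L.
    Membership is expressed by the finite inequalities of [dominated], which say that s k(x,y) -
    f(x) f(y) is positive semidefinite. They survive sums, Schur products and limits of power
    series, and tightness carries them from finite point masses to measures: the squared integral of
    g is at most s times the energy. Taking g = 0 gives nonnegativity of the energy, and zero energy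
    gives annihilation. *)

Definition quad {R : realType} {I : finType} (A : I -> I -> R) (c : I -> R) : R :=
  \sum_i \sum_j c i * c j * A i j.

(* For positive definite [k]: [f] lies in the RKHS of [k] and its squared norm
   is at most [s]. *)
Definition dominated {R : realType} {X : Type} (s : R) (k : X -> X -> R) (f : X -> R) : Prop :=
  forall (I : finType) (x : I -> X) (c : I -> R),
    (\sum_i c i * f (x i)) ^+ 2 <= s * quad (fun i j => k (x i) (x j)) c.

(** The discriminant criterion. For [a = 0] the expression is affine in [t], and [b <> 0] would let
    it reach -1; otherwise [t = - b / a] is its minimiser. *)
Lemma sqr_le_of_quadratic {R : realType} (a b q : R) : 0 <= a ->
  (forall t, 0 <= q + 2 * t * b + t ^+ 2 * a) -> b ^+ 2 <= a * q.
Proof.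
rewrite le_eqVlt => /predU1P[<-|a0] H.
  have [->|b0] := eqVneq b 0; first by rewrite expr0n mul0r.
  have := H (- (q + 1) / (2 * b)).
  suff -> : q + 2 * (- (q + 1) / (2 * b)) * b + (- (q + 1) / (2 * b)) ^+ 2 * 0 = -1.
    by rewrite ler0N1.
  by field.
have := H (- b / a); rewrite -(pmulr_rge0 _ a0).
suff -> : a * (q + 2 * (- b / a) * b + (- b / a) ^+ 2 * a) = a * q - b ^+ 2.
  by rewrite subr_ge0.
by field; rewrite gt_eqF.
Qed.

Section Quad.
Context {R : realType} {I : finType}.
Implicit Types (A B : I -> I -> R) (c : I -> R).

Lemma eq_quad A B c : (forall i j, A i j = B i j) -> quad A c = quad B c.
Proof. by move=> AB; apply: eq_bigr => i _; apply: eq_bigr => j _; rewrite AB. Qed.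

Lemma quadD A B c : quad (fun i j => A i j + B i j) c = quad A c + quad B c.
Proof.
rewrite /quad -big_split; apply: eq_bigr => i _ /=.
by rewrite -big_split; apply: eq_bigr => j _ /=; rewrite mulrDr.
Qed.

Lemma quadZ r A c : quad (fun i j => r * A i j) c = r * quad A c.
Proof.
rewrite /quad mulr_sumr; apply: eq_bigr => i _.
by rewrite mulr_sumr; apply: eq_bigr => j _; ring.
Qed.

Lemma quad_rank1 (f : I -> R) c :
  quad (fun i j => f i * f j) c = (\sum_i c i * f i) ^+ 2.
Proof.
rewrite /quad expr2 mulr_suml; apply: eq_bigr => i _.
by rewrite mulr_sumr; apply: eq_bigr => j _; ring.
Qed.

Lemma quad_scale (f : I -> R) A c :
  quad (fun i j => f i * f j * A i j) c = quad A (fun i => c i * f i).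
Proof. by rewrite /quad; apply: eq_bigr => i _; apply: eq_bigr => j _; ring. Qed.

Lemma quad_sum (T : Type) (r : seq T) (F : T -> I -> I -> R) c :
  quad (fun i j => \sum_(t <- r) F t i j) c = \sum_(t <- r) quad (F t) c.
Proof.
rewrite /quad [RHS]exchange_big /=; apply: eq_bigr => i _.
by rewrite [RHS]exchange_big /=; apply: eq_bigr => j _; rewrite mulr_sumr.
Qed.

Lemma sum_unit (F : I -> R) i0 : \sum_j (j == i0)%:R * F j = F i0.
Proof.
rewrite (bigD1 i0)//= eqxx mul1r big1 ?addr0// => i /negPf ->.
by rewrite mul0r.
Qed.

Lemma quad_unit A i0 : quad A (fun i => (i == i0)%:R) = A i0 i0.
Proof.
rewrite /quad -[RHS](sum_unit (fun i => A i i0)); apply: eq_bigr => i _.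
rewrite -(sum_unit (A i)) mulr_sumr; apply: eq_bigr => j _.
by rewrite mulrA.
Qed.

Lemma quad_add_unit A c i0 t : (forall i j, A i j = A j i) ->
  quad A (fun i => c i + t * (i == i0)%:R) =
  quad A c + 2 * t * (\sum_i c i * A i i0) + t ^+ 2 * A i0 i0.
Proof.
move=> Asym.
have H1 i : \sum_j (c i + t * (i == i0)%:R) * (c j + t * (j == i0)%:R) * A i j
  = \sum_j c i * c j * A i j + t * ((i == i0)%:R * (\sum_j c j * A j i))
    + t * (c i * A i i0) + t ^+ 2 * ((i == i0)%:R * A i i0).
  transitivity (\sum_j (c i * c j * A i j + t * (i == i0)%:R * (c j * A j i)
     + (t * c i + t ^+ 2 * (i == i0)%:R) * ((j == i0)%:R * A i j))).
    by apply: eq_bigr => j _; rewrite (Asym j i); ring.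
  by rewrite !big_split /= -!mulr_sumr sum_unit; ring.
rewrite /quad (eq_bigr _ (fun i _ => H1 i)) !big_split /= -!mulr_sumr.
by rewrite !sum_unit; ring.
Qed.

Lemma psd_diag_ge0 A i : (forall c, 0 <= quad A c) -> 0 <= A i i.
Proof. by move=> Apsd; rewrite -quad_unit. Qed.

(** Cauchy-Schwarz for the form of [A] between [c] and the unit vector at [i0]: adding [t] times
    that vector to [c] gives a nonnegative quadratic in [t]. *)
Lemma psd_col_le A c i0 : (forall i j, A i j = A j i) ->
  (forall c, 0 <= quad A c) ->
  (\sum_i c i * A i i0) ^+ 2 <= A i0 i0 * quad A c.
Proof.
move=> Asym Apsd; apply: sqr_le_of_quadratic => [|t]; first exact: psd_diag_ge0.
by rewrite -quad_add_unit.
Qed.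

Lemma psd_entry_le A i j : (forall i j, A i j = A j i) ->
  (forall c, 0 <= quad A c) -> A i j ^+ 2 <= A i i * A j j.
Proof.
move=> Asym Apsd; have := psd_col_le (fun l => (l == i)%:R) j Asym Apsd.
by rewrite sum_unit quad_unit mulrC.
Qed.

(* Symmetric Gaussian elimination: subtracting the rank one matrix
   [A i i0 * A i0 j / A i0 i0] preserves positivity and kills a diagonal
   entry. *)
Lemma psd_gram A : (forall i j, A i j = A j i) -> (forall c, 0 <= quad A c) ->
  exists G : seq (I -> R), forall i j, A i j = \sum_(g <- G) g i * g j.
Proof.
have [n] := ubnP #|[pred i | A i i != 0]|.
elim: n A => // n IH A nA Asym Apsd.
have [i0 Ai0|A0] := pickP [pred i | A i i != 0]; last first.
  exists [::] => i j; rewrite big_nil; apply/eqP.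
  rewrite -sqrf_eq0 eq_le sqr_ge0 andbT.
  apply: le_trans (psd_entry_le i j Asym Apsd) _.
  by have := A0 i => /= /negbFE/eqP ->; rewrite mul0r.
have {}Ai0 : A i0 i0 != 0 := Ai0.
have Ai0p : 0 < A i0 i0 by rewrite lt_neqAle eq_sym Ai0 psd_diag_ge0.
pose g i := A i i0 / Num.sqrt (A i0 i0).
have gg i j : g i * g j = A i i0 * A j i0 / A i0 i0.
  by rewrite /g mulrACA -invfM -expr2 sqr_sqrtr// ltW.
pose A' i j := A i j - g i * g j.
have [||c|G GE] := IH A'.
(* The count of nonzero diagonal entries drops: a zero diagonal entry forces its row to vanish by
   [psd_entry_le], so it stays zero, and the one at [i0] is cleared. *)
- rewrite -ltnS; apply: leq_trans nA; rewrite ltnS; apply: proper_card.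
  apply/properP; split.
    apply/fintype.subsetP => i; rewrite !inE; apply: contraNN => /eqP Ai.
    rewrite /A' gg Ai; have := psd_entry_le i i0 Asym Apsd.
    rewrite Ai mul0r => Ai2; have /eqP : A i i0 ^+ 2 = 0.
      by apply/eqP; rewrite eq_le Ai2 sqr_ge0.
    by rewrite sqrf_eq0 => /eqP ->; rewrite !mul0r subr0.
  by exists i0; rewrite !inE// /A' gg mulfK// subrr negbK.
- by move=> i j; rewrite /A' Asym [g i * _]mulrC.
- have -> : quad A' c = quad A c + -1 * quad (fun i j => g i * g j) c.
    rewrite -quadZ -quadD; apply: eq_quad => i j.
    by rewrite /A' mulN1r.
  rewrite quad_rank1 mulN1r subr_ge0.
  have -> : \sum_i c i * g i = (\sum_i c i * A i i0) / Num.sqrt (A i0 i0).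
    by rewrite mulr_suml; apply: eq_bigr => i _; rewrite /g mulrA.
  rewrite expr_div_n (sqr_sqrtr (ltW Ai0p)) ler_pdivrMr// mulrC.
  exact: psd_col_le.
- by exists (g :: G) => i j; rewrite big_cons -GE /A' addrC subrK.
Qed.

(** A Gram decomposition of [A] writes the entrywise product as a sum of copies of [B] rescaled by
    the vectors [g]. *)
Lemma schur A B c : (forall i j, A i j = A j i) -> (forall c, 0 <= quad A c) ->
  (forall c, 0 <= quad B c) -> 0 <= quad (fun i j => A i j * B i j) c.
Proof.
move=> Asym Apsd Bpsd; have [G GE] := psd_gram Asym Apsd.
have -> : quad (fun i j => A i j * B i j) c =
    quad (fun i j => \sum_(g <- G) g i * g j * B i j) c.
  by apply: eq_quad => i j; rewrite GE mulr_suml.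
by rewrite quad_sum; apply: sumr_ge0 => g _; rewrite quad_scale.
Qed.

End Quad.

Section Dominated.
Context {R : realType} {X : Type}.
Implicit Types (k : X -> X -> R) (f g : X -> R).

(** Domination of a single function thus doubles as the positivity hypothesis on [k] in what
    follows. *)
Lemma dominated_psd s k f (I : finType) (x : I -> X) c : 0 < s ->
  dominated s k f -> 0 <= quad (fun i j => k (x i) (x j)) c.
Proof.
move=> s0 /(_ I x c) H; rewrite -(pmulr_rge0 _ s0).
exact: le_trans (sqr_ge0 _) H.
Qed.

Lemma dominatedZ r s k f : dominated s k f ->
  dominated (r ^+ 2 * s) k (fun x => r * f x).
Proof.
move=> H I x c; have -> : \sum_i c i * (r * f (x i)) = r * \sum_i c i * f (x i).
  by rewrite mulr_sumr; apply: eq_bigr => i _; rewrite mulrCA.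
by rewrite exprMn -mulrA ler_wpM2l ?sqr_ge0.
Qed.

(** The factor 2 comes from [(a + b) ^+ 2 <= 2 * (a ^+ 2 + b ^+ 2)]. *)
Lemma dominatedD s t k f g : dominated s k f -> dominated t k g ->
  dominated (2 * (s + t)) k (fun x => f x + g x).
Proof.
move=> H1 H2 I x c; move: (H1 I x c) (H2 I x c).
have -> : \sum_i c i * (f (x i) + g (x i)) =
    \sum_i c i * f (x i) + \sum_i c i * g (x i).
  by rewrite -big_split; apply: eq_bigr => i _ /=; rewrite mulrDr.
set a := (\sum_i _); set b := (\sum_i _); set q := quad _ _ => ha hb.
have := sqr_ge0 (a - b); nra.
Qed.

(** Domination of [f] makes s k(x,y) - f(x) f(y) positive semidefinite. Its Schur product with [k']
    bounds the form of f(x) f(y) k'(x,y) by s times that of k k'; the former is the form of [k'] at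
    the coefficients c f, where domination of [g] applies. *)
Lemma dominated_mul s t k k' f g : 0 < s -> 0 < t ->
  (forall x y, k x y = k y x) -> (forall x y, k' x y = k' y x) ->
  dominated s k f -> dominated t k' g ->
  dominated (s * t) (fun x y => k x y * k' x y) (fun x => f x * g x).
Proof.
move=> s0 t0 ks ks' H1 H2 I x c.
pose A i j := s * k (x i) (x j) + -1 * (f (x i) * f (x j)).
have H c' : quad A c' = s * quad (fun i j => k (x i) (x j)) c'
     - (\sum_i c' i * f (x i)) ^+ 2.
  by rewrite quadD !quadZ quad_rank1 mulN1r.
have h : 0 <= quad (fun i j => A i j * k' (x i) (x j)) c.
  apply: schur => [i j|c'|c'].
  - by rewrite /A ks [f (x i) * _]mulrC.
  - by rewrite H subr_ge0.
  - exact: dominated_psd t0 H2.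
have {H} : quad (fun i j => A i j * k' (x i) (x j)) c =
    s * quad (fun i j => k (x i) (x j) * k' (x i) (x j)) c
    - quad (fun i j => k' (x i) (x j)) (fun i => c i * f (x i)).
  rewrite -quad_scale -quadZ -mulN1r -quadZ -quadD.
  by apply: eq_quad => i j; rewrite /A; ring.
move: h => /[swap] ->; rewrite subr_ge0 => h.
have -> : \sum_i c i * (f (x i) * g (x i)) = \sum_i c i * f (x i) * g (x i).
  by apply: eq_bigr => i _; rewrite mulrA.
apply: le_trans (H2 I x _) _; rewrite [s * t]mulrC -mulrA ler_wpM2l//.
exact: ltW.
Qed.

Lemma dominated_exp_pow s k f n : 0 < s -> (forall x y, k x y = k y x) ->
  dominated s k f ->
  dominated (s ^+ n) (fun x y => k x y ^+ n) (fun x => f x ^+ n).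
Proof.
move=> s0 ks H; elim: n => [|n IH].
  move=> I x c; rewrite expr0 mul1r.
  rewrite -(quad_rank1 (fun i => f (x i) ^+ 0) c).
  by rewrite le_eqVlt; apply/orP; left; apply/eqP; apply: eq_quad => i j;
    rewrite !expr0 mulr1.
have := dominated_mul s0 (exprn_gt0 n s0) ks
  (fun x y => f_equal (fun z => z ^+ n) (ks x y)) H IH.
move=> h I x c; rewrite (exprS s).
have -> : \sum_i c i * f (x i) ^+ n.+1 = \sum_i c i * (f (x i) * f (x i) ^+ n).
  by apply: eq_bigr => i _; rewrite exprS.
have -> : quad (fun i j => k (x i) (x j) ^+ n.+1) c =
    quad (fun i j => k (x i) (x j) * k (x i) (x j) ^+ n) c.
  by apply: eq_quad => i j; rewrite exprS.
exact: h.
Qed.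

Lemma cvg_series_exp (z : R) : series (exp_coeff z) @ \oo --> expR z.
Proof. exact: is_cvg_series_exp_coeff. Qed.

Lemma cvg_series_cos (z : R) : series (cos_coeff z) @ \oo --> cos z.
Proof. rewrite unlock; exact: is_cvg_series_cos_coeff. Qed.

Lemma cvg_sum_fin (I : finType) (u : I -> nat -> R) (l : I -> R) :
  (forall i, u i @ \oo --> l i) ->
  (fun N => \sum_i u i N) @ \oo --> \sum_i l i.
Proof. by move=> ul; apply: cvg_big => //; exact: add_continuous. Qed.

(* Compare the power series of [e^k] and of [cos] term by term: the Schur
   powers of [k] dominate the powers of [f]. *)
Lemma dominated_exp_cos s k f : 0 < s -> (forall x y, k x y = k y x) ->
  dominated s k f ->
  dominated (expR s) (fun x y => expR (k x y)) (fun x => cos (f x)).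
Proof.
move=> s0 ks H I x c; apply: sqr_le_of_quadratic => [|t]; first exact: expR_ge0.
(* Partial sums of the quadratic in [t]; each of their terms is nonnegative, and this passes to the
   limit. *)
pose u := fun N => \sum_i \sum_j c i * c j * series (exp_coeff (k (x i) (x j))) N
  + 2 * t * (\sum_i c i * series (cos_coeff (f (x i))) N)
  + t ^+ 2 * series (exp_coeff s) N.
have ucvg : u @ \oo --> quad (fun i j => expR (k (x i) (x j))) c
   + 2 * t * (\sum_i c i * cos (f (x i))) + t ^+ 2 * expR s.
  apply: cvgD; first apply: cvgD.
  - apply: cvg_sum_fin => i; apply: cvg_sum_fin => j.
    by apply: cvgMl_tmp; exact: cvg_series_exp.
  - by apply: cvgMl_tmp; apply: cvg_sum_fin => i; apply: cvgMl_tmp; exact: cvg_series_cos.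
  - by apply: cvgMl_tmp; exact: cvg_series_exp.
rewrite -(cvg_lim (@Rhausdorff R) ucvg).
apply: limr_ge; first by apply/cvg_ex; eexists; exact: ucvg.
apply: nearW => N; rewrite /u.
have -> : \sum_i \sum_j c i * c j * series (exp_coeff (k (x i) (x j))) N
    = \sum_(0 <= n < N) quad (fun i j => k (x i) (x j) ^+ n) c / n`!%:R.
  rewrite /series /=; transitivity
    (quad (fun i j => \sum_(0 <= n < N) exp_coeff (k (x i) (x j)) n) c) => //.
  rewrite quad_sum; apply: eq_bigr => n _.
  rewrite mulrC -quadZ; apply: eq_quad => i j.
  by rewrite /exp_coeff /=; ring.
have -> : \sum_i c i * series (cos_coeff (f (x i))) N
    = \sum_(0 <= n < N) ((~~ odd n)%:R * (-1) ^+ n./2) * (\sum_i c i * f (x i) ^+ n) / n`!%:R.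
  under eq_bigr do rewrite /series /= mulr_sumr.
  rewrite exchange_big /=; apply: eq_bigr => n _.
  rewrite mulr_sumr mulr_suml; apply: eq_bigr => i _.
  by rewrite /cos_coeff /= mulrA mulrCA.
rewrite /series /= !mulr_sumr -!big_split /= sumr_ge0// => n _.
(* [al] is 0, 1 or -1: the cosine coefficient freed of its factorial. After multiplication by
   [s ^+ n] the square can be completed, and [dominated_exp_pow] controls the remainder. *)
set q := quad _ _; set P := (\sum_i _); set al := (_ * _ ^+ n./2).
have al1 : al ^+ 2 <= 1.
  rewrite /al; case: (odd n) => /=; first by rewrite mul0r expr0n ler01.
  by rewrite mul1r -exprM mulnC exprM sqrrN !expr1n.
have Pq : P ^+ 2 <= s ^+ n * q := dominated_exp_pow n s0 ks H x c.
have sn : 0 < s ^+ n by rewrite exprn_gt0.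
have -> : q / n`!%:R + 2 * t * (al * P / n`!%:R) + t ^+ 2 * exp_coeff s n =
    (q + 2 * t * (al * P) + t ^+ 2 * s ^+ n) / n`!%:R.
  by rewrite /exp_coeff /= !mulrA -!mulrDl.
rewrite divr_ge0 ?ler0n// -(pmulr_rge0 _ sn); move: al al1 => {u ucvg} al al1.
rewrite [leRHS](_ : _ =
  (t * s ^+ n + al * P) ^+ 2 + (s ^+ n * q - al ^+ 2 * P ^+ 2)); last by ring.
rewrite addr_ge0 ?sqr_ge0// subr_ge0; apply: le_trans Pq.
by rewrite ler_piMl ?sqr_ge0.
Qed.

End Dominated.

(** * From conditionally negative definite to positive definite kernels *)

Lemma big_optionE {R : nmodType} {I : finType} (F : option I -> R) :
  \sum_i F i = F None + \sum_i F (Some i).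
Proof.
rewrite (bigD1 None)//=; congr (_ + _).
by rewrite (reindex_omap Some id)//; [apply: eq_bigl => i; rewrite eqxx|case].
Qed.

Lemma quad_option {R : realType} {I : finType} (A : option I -> option I -> R) c :
  quad A c = c None ^+ 2 * A None None
    + c None * (\sum_i c (Some i) * (A None (Some i) + A (Some i) None))
    + quad (fun i j => A (Some i) (Some j)) (fun i => c (Some i)).
Proof.
rewrite /quad big_optionE big_optionE.
under [X in _ + X = _]eq_bigr do rewrite big_optionE.
rewrite big_split /= addrA; congr (_ + _); rewrite -addrA; congr (_ + _).
by rewrite -big_split mulr_sumr; apply: eq_bigr => i _ /=; ring.
Qed.

Lemma quad_comp {R : realType} {I J : finType} (h : I -> J) (G : J -> J -> R) c :
  quad (fun i j => G (h i) (h j)) c =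
  quad G (fun l => \sum_(i | h i == l) c i).
Proof.
rewrite /quad (partition_big h predT)//=; apply: eq_bigr => l _.
under [RHS]eq_bigr do rewrite mulr_suml mulr_suml.
rewrite [RHS]exchange_big /=; apply: eq_bigr => i /eqP ->.
rewrite (partition_big h predT)//=; apply: eq_bigr => m _.
by rewrite mulr_sumr mulr_suml; apply: eq_bigr => j /eqP ->.
Qed.

(** In the RKHS the section has squared norm [k z z]. Adjoining [z] to the family with coefficient 0
    reduces the bound to [psd_col_le]. *)
Lemma dominated_section {R : realType} {X : Type} (k : X -> X -> R) z :
  (forall x y, k x y = k y x) ->
  (forall (I : finType) (x : I -> X) c, 0 <= quad (fun i j => k (x i) (x j)) c) ->
  dominated (k z z) k (k^~ z).
Proof.
move=> ksym psd I x c.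
pose y (i : option I) := if i is Some i then x i else z.
pose c' (i : option I) := if i is Some i then c i else 0.
have := psd_col_le c' None (fun i j => ksym (y i) (y j)) (psd _ y).
by rewrite big_optionE /= mul0r add0r quad_option /= expr0n /= !mul0r !add0r.
Qed.

(* [cond_neg_def] only mentions distinct points; coefficients of repeated
   points are added up. *)
Lemma cnd_family {R : realType} {X : choiceType} (g : X -> X -> R)
    (I : finType) (x : I -> X) c :
  cond_neg_def g -> \sum_i c i = 0 -> quad (fun i j => g (x i) (x j)) c <= 0.
Proof.
move=> [_ gneg] c0.
pose J : finType := seq_sub (codom x).
pose h i : J := SeqSub (codom_f x i).
rewrite (quad_comp h (fun l m => g (val l) (val m))).
pose d l := \sum_(i | h i == l) c i; rewrite -/d; pose y (i : 'I_#|J|) := val (enum_val i : J).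
have yinj : injective y by move=> i j /val_inj /enum_val_inj.
have reind (F : J -> R) : \sum_l F l = \sum_(i < #|J|) F (enum_val i).
  by rewrite (reindex _ (onW_bij _ (@enum_val_bij J))).
have H := gneg _ y (fun i => d (enum_val i)) yinj.
rewrite /quad reind; under eq_bigr do rewrite reind.
by apply: H; rewrite -(reind d) -[RHS]c0 (partition_big h predT).
Qed.

Section BasedKernel.
Context {R : realType} {X : choiceType}.
Variables (g : X -> X -> R) (x0 : X).
Hypothesis gcnd : cond_neg_def g.

(* Twice the inner product of the Hilbert space embedding of [g] that sends [x0]
   to 0; the summand 1 makes the constants dominated. *)
Definition based_kernel x y := 1 + (g x x0 + g x0 y - g x y - g x0 x0).

Let gsym : forall x y, g x y = g y x := proj1 gcnd.

Lemma based_kernel_sym x y : based_kernel x y = based_kernel y x.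
Proof. by rewrite /based_kernel (gsym x y) (gsym x x0) (gsym x0 y); ring. Qed.

(** The bound means that [based_kernel] minus 1 is positive semidefinite. Giving [x0] the
    coefficient [- \sum_i c i] makes the total zero, so [cnd_family] applies to the enlarged
    family. *)
Lemma based_kernel_cst : dominated 1 based_kernel (fun=> 1).
Proof.
move=> I x c; rewrite mul1r /based_kernel.
rewrite (quadD (fun _ _ => 1)) -[X in X <= _]addr0 lerD//.
  rewrite -quad_rank1 le_eqVlt; apply/orP; left; apply/eqP.
  by apply: eq_quad => i j; rewrite mulr1.
pose y (i : option I) := if i is Some i then x i else x0.
pose c' (i : option I) := if i is Some i then c i else - \sum_i c i.
have := cnd_family y gcnd (c := c') _; rewrite big_optionE addNr => /(_ erefl).
rewrite -oppr_ge0; congr (_ <= _); rewrite quad_option /=.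
have -> : quad (fun i j => g (x i) x0 + g x0 (x j) - g (x i) (x j) - g x0 x0) c
  = quad (fun i j => (-1) * g (x i) (x j)) c +
    quad (fun i j => g (x i) x0) c + quad (fun i j => g x0 (x j)) c
     + quad (fun i j => - g x0 x0) c.
  by rewrite -!quadD; apply: eq_quad => i j; ring.
rewrite quadZ.
have -> : quad (fun i _ => g (x i) x0) c = (\sum_i c i) * (\sum_i c i * g (x i) x0).
  rewrite /quad mulrC mulr_suml; apply: eq_bigr => i _.
  by rewrite mulr_sumr; apply: eq_bigr => j _; ring.
have -> : quad (fun _ j => g x0 (x j)) c = (\sum_i c i) * (\sum_i c i * g x0 (x i)).
  rewrite /quad mulr_suml; apply: eq_bigr => i _.
  by rewrite mulr_sumr; apply: eq_bigr => j _; ring.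
have -> : quad (fun _ _ => - g x0 x0) c = - g x0 x0 * (\sum_i c i) ^+ 2.
  have -> : \sum_i c i = \sum_i c i * 1 by apply: eq_bigr => i; rewrite mulr1.
  by rewrite -quad_rank1 -quadZ; apply: eq_quad => i j; rewrite !mulr1.
have -> : \sum_i c i * (g x0 (x i) + g (x i) x0) =
    \sum_i c i * g x0 (x i) + \sum_i c i * g (x i) x0.
  by rewrite -big_split; apply: eq_bigr => i _ /=; rewrite mulrDr.
by rewrite -[quad _ [eta c]]/(quad _ c); ring.
Qed.

Lemma based_kernel_section z :
  dominated (based_kernel z z + 1) based_kernel (based_kernel^~ z).
Proof.
have psd (I : finType) (x : I -> X) c := dominated_psd x c ltr01 based_kernel_cst.
move=> I x c; apply: le_trans (dominated_section z based_kernel_sym psd x c) _.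
by rewrite ler_wpM2r// lerDl.
Qed.

End BasedKernel.

Lemma dominated_weight {R : realType} {X : Type} (s C : R) (k : X -> X -> R)
    (w f : X -> R) : 0 < C -> dominated s k f ->
  dominated (s / C) (fun x y => C * (w x * w y * k x y)) (fun x => w x * f x).
Proof.
move=> C0 H I x c; rewrite quadZ mulrA divfK ?gt_eqF// quad_scale.
have -> : \sum_i c i * (w (x i) * f (x i)) = \sum_i c i * w (x i) * f (x i).
  by apply: eq_bigr => i _; rewrite mulrA.
exact: H.
Qed.

Section InverseKernel.
Context {R : realType} {X : choiceType}.
Variable (L : X -> X -> R).
Hypothesis Llog : log_conditional L.

Let L_gt0 x y : 0 < L x y.
Proof. by case: Llog => L1 _ _; exact: lt_le_trans ltr01 (L1 x y). Qed.

(** The factor [expR 1] undoes the summand 1 of [based_kernel]. *)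
Lemma inverse_kernelE x0 x y : inverse_kernel L x y =
  (L x0 x0 / expR 1) * ((L x x0)^-1 * (L y x0)^-1 * expR (based_kernel (log_kernel L) x0 x y)).
Proof.
have [_ Lsym _] := Llog.
rewrite /based_kernel /log_kernel /inverse_kernel.
rewrite expRD expRB expRB expRD !lnK ?posrE// (Lsym x0 y).
by field; rewrite !gt_eqF ?expR_gt0.
Qed.

Lemma inverse_kernel_dominated x0 s f : 0 < s ->
  dominated s (based_kernel (log_kernel L) x0) f ->
  dominated (expR s / (L x0 x0 / expR 1)) (inverse_kernel L)
    (fun x => (L x x0)^-1 * cos (f x)).
Proof.
move=> s0 /(dominated_exp_cos s0 (based_kernel_sym x0 (let: And3 _ _ h := Llog in h))).
move=> /(dominated_weight (fun x => (L x x0)^-1) (divr_gt0 (L_gt0 x0 x0) (expR_gt0 1))).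
move=> H I x c; have := H I x c.
congr (_ <= _ * _); apply: eq_quad => i j.
by rewrite (inverse_kernelE x0).
Qed.

End InverseKernel.

(** * Uniform closure of the span of cosines *)

(** Compactness as an induction principle, in place of finite subcovers. If [Pr C] failed, the sets
    whose relative complement in [C] satisfies [Pr] would form a proper filter containing [C]; at a
    cluster point in [C] the local hypothesis is contradictory. *)
Lemma compact_ind {X : topologicalType} (C : set X) (Pr : set X -> Prop) :
  compact C -> Pr set0 -> (forall A B, A `<=` B -> Pr B -> Pr A) ->
  (forall A B, Pr A -> Pr B -> Pr (A `|` B)) ->
  (forall x, C x -> exists2 U, nbhs x U & Pr U) -> Pr C.
Proof.
move=> cC Pr0 PrS PrU loc; apply: contrapT => nPr.
pose F : set_system X := [set B | Pr (C `\` B)].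
have FF : ProperFilter F.
  split; first by rewrite /F /= setD0.
  split.
  - by rewrite /F /= setDT.
  - by move=> A B; rewrite /F /= setDIr; exact: PrU.
  - by move=> A B AB; rewrite /F /=; apply: PrS; exact: setDS.
have [|x [Cx clx]] := cC F FF; first by rewrite /F /= setDv.
have [U xU PrUx] := loc x Cx.
have [|y []] := clx (~` U) U _ xU; last by [].
by rewrite /F /= setDE setCK; apply: PrS PrUx => y [].
Qed.

(* Newton-like iteration for [sqrt (t ^+ 2)], uniform on [[-1, 1]]. *)
Fixpoint abs_iter {R : realType} (n : nat) (t : R) : R :=
  if n is m.+1 then abs_iter m t + (t ^+ 2 - abs_iter m t ^+ 2) / 2 else 0.

(** With s the modulus of t, the error e becomes e (1 - s + e / 2) in one step. Since e <= s this is
    at most e (1 - e / 2), which decays like 2 / n uniformly in t. *)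
Lemma abs_iter_le {R : realType} n (t : R) : `|t| <= 1 ->
  0 <= `|t| - abs_iter n t <= `|t| /\ (`|t| - abs_iter n t) * n.+1%:R <= 2.
Proof.
move=> t1; elim: n => [|n [/andP[h0 h1] h2]] /=.
  rewrite subr0 normr_ge0 lexx mulr1; split => //.
  by apply: le_trans t1 _; rewrite ler1n.
set p := abs_iter n t in h0 h1 h2 *.
have -> : t ^+ 2 = `|t| ^+ 2 by rewrite real_normK ?num_real.
set s := `|t| in t1 h0 h1 h2 *; set e := s - p in h0 h1 h2.
have -> : s - (p + (s ^+ 2 - p ^+ 2) / 2) = e * (1 - s + e / 2).
  by rewrite /e; field.
have s0 : 0 <= s by exact: normr_ge0.
have m0 : (0 : R) <= n.+1%:R by exact: ler0n.
split; first by apply/andP; split; nra.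
rewrite -[n.+2]addn1 natrD; set N : R := n.+1%:R in h2 m0 *.
(* These two products and [e ^+ 2 / 2] add up to 2 minus the new error times [N + 1]. *)
have : 0 <= (2 - e * N) * (1 - e / 2) by apply: mulr_ge0; lra.
have : 0 <= e * (s - e) * (N + 1) by apply: mulr_ge0; [apply: mulr_ge0|]; lra.
by nra.
Qed.

(** With limits as a constructor the family is uniformly closed by construction, and its properties
    are proved by induction on membership. *)
Inductive cos_closure {R : realType} {X : Type} (F : (X -> R) -> Prop) :
    (X -> R) -> Prop :=
| cos_closure_gen f : F f -> cos_closure F (fun x => cos (f x))
| cos_closureD a b : cos_closure F a -> cos_closure F b ->
    cos_closure F (fun x => a x + b x)
| cos_closureZ r a : cos_closure F a -> cos_closure F (fun x => r * a x)
| cos_closure_lim (u : nat -> X -> R) a : (forall n, cos_closure F (u n)) ->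
    (forall n x, `|a x - u n x| <= n.+1%:R^-1) -> cos_closure F a.

Lemma exists_invS_lt {R : realType} (e : R) : 0 < e -> exists n, n.+1%:R^-1 < e.
Proof.
move=> e0; exists (Num.bound e^-1).
rewrite invf_plt ?posrE// (lt_trans (archi_boundP _)) ?ltr_nat//.
by rewrite invr_ge0 ltW.
Qed.

Section CosClosure.
Context {R : realType} {X : Type} {F : (X -> R) -> Prop}.
Hypothesis F1 : F (fun=> 1).
Hypothesis FD : forall f g, F f -> F g -> F (fun x => f x + g x).
Hypothesis FZ : forall r f, F f -> F (fun x => r * f x).
Local Notation A := (cos_closure F).

Lemma cos_closure_eq a b : a =1 b -> A a -> A b.
Proof. by move=> /funext ->. Qed.

Lemma cos_closure_cst r : A (fun=> r).
Proof.
apply: (@cos_closure_eq (fun=> r * cos (0 * 1))) => [x|].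
  by rewrite mul0r cos0 mulr1.
exact/cos_closureZ/(@cos_closure_gen _ _ _ (fun=> 0 * 1))/FZ.
Qed.

Lemma cos_closure_bounded a : A a ->
  exists2 M, 0 < M & forall x, `|a x| <= M.
Proof.
elim=> {a} [f Ff|a b _ [M M0 aM] _ [N N0 bN]|r a _ [M M0 aM]|u a _ IH ua].
- by exists 1 => // x; rewrite ler_norml cos_geN1 cos_le1.
- exists (M + N); first exact: addr_gt0.
  by move=> x; apply: le_trans (ler_normD _ _) _; exact: lerD.
- exists ((`|r| + 1) * M); first by rewrite mulr_gt0// ltr_pwDr.
  by move=> x; rewrite normrM ler_pM ?normr_ge0// lerDl.
- have [M M0 uM] := IH 0%N; exists (M + 1); first exact: addr_gt0.
  move=> x; rewrite -[a x](subrK (u 0%N x)) addrC.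
  apply: le_trans (ler_normD _ _) _; rewrite lerD//.
  by apply: le_trans (ua 0%N x) _; rewrite invr1.
Qed.

Lemma cos_closure_limP a :
  (forall e, 0 < e -> exists2 b, A b & forall x, `|a x - b x| <= e) -> A a.
Proof.
move=> H; have /choice[u uP] n : exists b, A b /\ forall x, `|a x - b x| <= n.+1%:R^-1.
  by have [|b] := H n.+1%:R^-1; [rewrite invr_gt0|exists b].
by apply: (@cos_closure_lim _ _ _ u) => n; case: (uP n).
Qed.

(** On generators this is the product-to-sum formula, which stays inside because [F] is a vector
    space. The limit cases use boundedness of the other factor. *)
Lemma cos_closureM a b : A a -> A b -> A (fun x => a x * b x).
Proof.
move=> Aa Ab; have [N N0 bN] := cos_closure_bounded Ab.
elim: Aa => {a} [f Ff|a a' _ Aab _ Aab'|r a _ Aab|u a Au IH ua].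
- elim: Ab {N N0 bN} => {b} [g Fg|b b' _ Ab _ Ab'|r b _ Ab|v b Av IH vb].
  + apply: (@cos_closure_eq (fun x => 2^-1 *
        (cos (f x + g x) + cos (f x + -1 * g x)))) => [x|].
      by rewrite mulN1r cosD cosB; field.
    apply/cos_closureZ/cos_closureD.
      exact/(@cos_closure_gen _ _ _ (fun x => f x + g x))/FD.
    apply/(@cos_closure_gen _ _ _ (fun x => f x + -1 * g x))/FD => //.
    exact: FZ.
  + by apply: cos_closure_eq (cos_closureD Ab Ab') => x; rewrite mulrDr.
  + by apply: cos_closure_eq (cos_closureZ r Ab) => x; rewrite mulrCA.
  + apply: (cos_closure_lim IH) => n x; rewrite -mulrBr normrM.
    apply: le_trans (vb n x); rewrite ler_piMl//.
    by rewrite ler_norml cos_geN1 cos_le1.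
- by apply: cos_closure_eq (cos_closureD Aab Aab') => x; rewrite mulrDl.
- by apply: cos_closure_eq (cos_closureZ r Aab) => x; rewrite mulrA.
- apply: cos_closure_limP => e e0.
  have [n ne] := exists_invS_lt (divr_gt0 e0 N0).
  exists (fun x => u n x * b x) => // x; rewrite -mulrBl normrM.
  rewrite -[leRHS](divfK (lt0r_neq0 N0)) ler_pM// (le_trans (ua n x))//.
  exact: ltW.
Qed.

Lemma cos_closure_abs a : A a -> A (fun x => `|a x|).
Proof.
move=> Aa; have [M M0 aM] := cos_closure_bounded Aa.
have Aiter n : A (fun x => abs_iter n (M^-1 * a x)).
  elim: n => [|n IH] /=; first exact: cos_closure_cst.
  have sq b : A b -> A (fun x => b x ^+ 2).
    by move=> Ab; apply: cos_closure_eq (cos_closureM Ab Ab) => x; rewrite expr2.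
  have := cos_closureD (cos_closureZ 2^-1 (sq _ (cos_closureZ M^-1 Aa)))
    (cos_closureZ (- 2^-1) (sq _ IH)).
  by move=> /(cos_closureD IH); apply: cos_closure_eq => x; field; lra.
apply: (@cos_closure_eq (fun x => M * `|M^-1 * a x|)) => [x|].
  by rewrite normrM gtr0_norm ?invr_gt0// mulVKf ?gt_eqF.
apply: cos_closureZ.
(* At index 2n + 1 the error bound 2 / (2n + 2) is the required 1 / (n + 1). *)
apply: (@cos_closure_lim _ _ _ (fun n x => abs_iter n.*2.+1 (M^-1 * a x))) => // n x.
have [|/andP[h0 _] h] := @abs_iter_le R n.*2.+1 (M^-1 * a x).
  by rewrite normrM gtr0_norm ?invr_gt0// ler_pdivrMl// mulr1.
have E : n.*2.+2%:R = n.+1%:R * 2 :> R by rewrite -doubleS -muln2 natrM.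
rewrite ger0_norm//; move: h; rewrite E mulrA.
by rewrite -ler_pdivlMr// divff// => h; rewrite -[leRHS]mul1r ler_pdivlMr.
Qed.

Lemma cos_closure_max a b : A a -> A b -> A (fun x => Num.max (a x) (b x)).
Proof.
move=> Aa Ab; have := cos_closureZ 2^-1 (cos_closureD (cos_closureD Aa Ab)
  (cos_closure_abs (cos_closureD Aa (cos_closureZ (-1) Ab)))).
apply: cos_closure_eq => x; rewrite mulN1r.
by rewrite maxr_absE mulrC.
Qed.

Lemma cos_closure_min a b : A a -> A b -> A (fun x => Num.min (a x) (b x)).
Proof.
move=> Aa Ab.
have := cos_closureZ (-1) (cos_closure_max (cos_closureZ (-1) Aa) (cos_closureZ (-1) Ab)).
by apply: cos_closure_eq => x; rewrite !mulN1r oppr_max !opprK.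
Qed.

End CosClosure.

Lemma cos_closure_continuous {R : realType} {X : topologicalType}
    (F : (X -> R) -> Prop) a :
  (forall f, F f -> continuous f) -> cos_closure F a -> continuous a.
Proof.
move=> Fc; elim=> {a} [f Ff|a b _ ac _ bc|r a _ ac|u a _ uc ua] x.
- by apply: continuous_comp; [exact: Fc|exact: continuous_cos].
- exact: (continuousD (ac x) (bc x)).
- exact: (continuousM (@cst_continuous _ _ r x) (ac x)).
- apply/cvgrPdist_le => e e0.
  have e3 : 0 < e / 3 by rewrite divr_gt0.
  have [n ne] := exists_invS_lt e3.
  have /cvgrPdist_le/(_ _ e3) := uc n x; apply: filterS => y uxy.
  have -> : a x - a y = (a x - u n x) + (u n x - u n y) + - (a y - u n y) by ring.
  apply: le_trans (ler_normD _ _) _; rewrite normrN.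
  apply: le_trans (lerD (ler_normD _ _) (ua n y)) _.
  apply: le_trans (lerD (lerD (le_trans (ua n x) (ltW ne)) uxy) (ltW ne)) _.
  by rewrite le_eqVlt; apply/orP; left; apply/eqP; field.
Qed.

(** The lattice argument in two rounds: minima over neighbourhoods covering [D] for a fixed point of
    [C], then maxima over neighbourhoods covering [C]. Clamping to [-1, 1] turns the inequalities on
    [C] and [D] into equalities and bounds the function elsewhere. *)
Lemma cos_closure_separates {R : realType} {X : topologicalType}
    (F : (X -> R) -> Prop) (C D : set X) :
  F (fun=> 1) -> (forall f g, F f -> F g -> F (fun x => f x + g x)) ->
  (forall r f, F f -> F (fun x => r * f x)) ->
  (forall f, F f -> continuous f) ->
  (forall x y, x <> y -> exists2 f, F f & f x <> f y) ->
  compact C -> compact D -> C `&` D = set0 ->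
  exists b, [/\ cos_closure F b, forall x, `|b x| <= 1,
    forall x, C x -> b x = 1 & forall x, D x -> b x = -1].
Proof.
move=> F1 FD FZ Fc Fsep cC cD CD.
have Ac := cos_closure_continuous Fc.
have sep x y : x <> y -> exists2 a, cos_closure F a & a x = 1 /\ a y = -1.
  move=> /Fsep[f Ff /eqP fxy]; have d0 : f y - f x != 0 by rewrite subr_eq0 eq_sym.
  (* The affine change sends [f x] to 0 and [f y] to [pi]. *)
  exists (fun z => cos (pi / (f y - f x) * (f z + - f x * 1))).
    apply: cos_closure_gen; apply: (FZ); apply: FD => //; exact: FZ.
  by rewrite !mulr1 subrr mulr0 cos0 divfK// cospi.
have open_near (a : X -> R) x (U : set R) : continuous a -> open U -> U (a x) ->
    nbhs x (a @^-1` U).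
  by move=> ac oU Ux; apply: ac; exact: open_nbhs_nbhs.
have H1 x : C x -> exists2 a, cos_closure F a & 1 < a x /\ forall y, D y -> a y <= -1.
  move=> Cx; apply: (@compact_ind _ D (fun V => exists2 a, cos_closure F a &
      1 < a x /\ forall y, V y -> a y <= -1)) => //.
  - exists (fun=> 2); first exact: cos_closure_cst.
    by split => //; rewrite ltr1n.
  - by move=> V W VW [a Aa [ax aW]]; exists a => //; split => // y /VW; exact: aW.
  - move=> V W [a Aa [ax aV]] [b Ab [bx bW]].
    exists (fun x => Num.min (a x) (b x)); first exact: cos_closure_min.
    by split=> [|y [/aV|/bW]]; rewrite ?lt_min ?ax// => h; rewrite ge_min h ?orbT.
  - move=> y Dy; have xy : x <> y.
      by move=> xy; rewrite -xy in Dy; have : (C `&` D) x by []; rewrite CD.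
    have [a Aa [ax ay]] := sep x y xy.
    (* Doubling [a] leaves room on both sides: the value at [x] becomes 2, and on this neighbourhood
       of [y] it is below -1. *)
    exists [set z | a z < - 2^-1].
      apply: (@open_near a y [set t | t < - 2^-1]) => //; [exact: Ac|].
      by rewrite /= ay; lra.
    exists (fun z => 2 * a z); first exact: cos_closureZ.
    by split=> [|z /= az]; [rewrite ax|]; lra.
have [b Ab [bC bD]] : exists2 b, cos_closure F b &
    (forall x, C x -> 1 <= b x) /\ forall y, D y -> b y <= -1.
  apply: (@compact_ind _ C (fun V => exists2 b, cos_closure F b &
      (forall x, V x -> 1 <= b x) /\ forall y, D y -> b y <= -1)) => //.
  - exists (fun=> -1); first exact: cos_closure_cst.
    by split.
  - by move=> V W VW [a Aa [aW aD]]; exists a => //; split => // y /VW; exact: aW.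
  - move=> V W [a Aa [aV aD]] [b Ab [bW bD]].
    exists (fun x => Num.max (a x) (b x)); first exact: cos_closure_max.
    split=> [y [/aV|/bW] h|y Dy]; rewrite ?le_max ?h ?orbT// ge_max.
    by rewrite aD// bD.
  - move=> x /H1[a Aa [ax aD]]; exists [set z | 1 < a z].
      by apply: (@open_near a x [set t | 1 < t]) => //; exact: Ac.
    by exists a => //; split => // z /= /ltW.
exists (fun x => Num.max (-1) (Num.min 1 (b x))); split.
- apply: cos_closure_max => //; first exact: cos_closure_cst.
  by apply: cos_closure_min => //; exact: cos_closure_cst.
- move=> x; rewrite ler_norml le_max lexx /= ge_max ge_min lexx andbT /=; lra.
- by move=> x /bC bx; rewrite (min_idPl bx); apply/max_idPr; lra.
- move=> x /bD bx; have -> : Num.min 1 (b x) = b x by apply/min_idPr; lra.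
  exact/max_idPl.
Qed.

(** * Integrals of bounded functions against a difference of finite measures *)

Definition bounded_measurable {d} {T : measurableType d} {R : realType}
    (f : T -> R) : Prop :=
  measurable_fun setT f /\ exists M, forall x, `|f x| <= M.

Section BoundedMeasurable.
Context {d} {T : measurableType d} {R : realType}.
Implicit Types (f g : T -> R) (m : {finite_measure set T -> \bar R}).

Lemma bounded_measurable_cst (r : R) : bounded_measurable (fun _ : T => r).
Proof. by split; [exact: measurable_cst|exists `|r|]. Qed.

Lemma bounded_measurableD f g : bounded_measurable f -> bounded_measurable g ->
  bounded_measurable (fun x => f x + g x).
Proof.
move=> [mf [M fM]] [mg [N gN]]; split; first exact: measurable_funD.
by exists (M + N) => x; apply: le_trans (ler_normD _ _) _; exact: lerD.
Qed.

Lemma bounded_measurableM f g : bounded_measurable f -> bounded_measurable g ->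
  bounded_measurable (fun x => f x * g x).
Proof.
move=> [mf [M fM]] [mg [N gN]]; split; first exact: measurable_funM.
by exists (M * N) => x; rewrite normrM ler_pM.
Qed.

Lemma bounded_measurableZ r f : bounded_measurable f ->
  bounded_measurable (fun x => r * f x).
Proof. exact/bounded_measurableM/bounded_measurable_cst. Qed.

Lemma bounded_measurable_norm f : bounded_measurable f ->
  bounded_measurable (fun x => `|f x|).
Proof.
move=> [mf [M fM]]; split; first exact: measurableT_comp.
by exists M => x; rewrite normr_id.
Qed.

Lemma bounded_measurable_indic (A : set T) : measurable A ->
  bounded_measurable (\1_A : T -> R).
Proof.
move=> mA; split; first exact: measurable_indic.
by exists 1 => x; rewrite indicE; case: (_ \in _); rewrite ?normr1 ?normr0.
Qed.

Lemma bounded_measurable_sum (I : Type) (s : seq I) (f : I -> T -> R) :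
  (forall i, bounded_measurable (f i)) ->
  bounded_measurable (fun x => \sum_(i <- s) f i x).
Proof.
move=> bf; elim: s => [|i s IH].
  rewrite (_ : (fun _ => _) = fun=> 0); first exact: bounded_measurable_cst.
  by apply/funext => x; rewrite big_nil.
rewrite (_ : (fun _ => _) = fun x => f i x + \sum_(j <- s) f j x).
  exact: bounded_measurableD.
by apply/funext => x; rewrite big_cons.
Qed.

Lemma bounded_measurable_integrable m f : bounded_measurable f ->
  m.-integrable setT (EFin \o f).
Proof.
move=> [mf [M fM]]; apply: measurable_bounded_integrable => //.
  by rewrite ltey_eq fin_num_measure.
exists M; split; first exact: num_real.
by move=> N MN x _; apply: le_trans (fM x) (ltW MN).
Qed.

Lemma Rintegral_indic m (A : set T) : measurable A ->
  \int[m]_x (\1_A x : R) = fine (m A).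
Proof. by move=> mA; rewrite /Rintegral integral_indic// setIT. Qed.

(** [e] is the accuracy away from [A], and [M] a crude extra bound on [A], which has small mass when
    tightness or regularity is used. *)
Lemma Rintegral_le_tail m f (e M : R) (A : set T) : bounded_measurable f ->
  measurable A -> (forall x, `|f x| <= e + M * \1_A x) ->
  `|\int[m]_x f x| <= e * fine (m setT) + M * fine (m A).
Proof.
move=> bf mA fe; apply: le_trans (le_normr_Rintegral _ _) _ => //.
  exact: bounded_measurable_integrable.
have b1 := bounded_measurable_cst e.
have b2 := bounded_measurableZ M (bounded_measurable_indic mA).
rewrite -(Rintegral_cst m measurableT e) -(Rintegral_indic m mA).
rewrite -RintegralZl//; last first.
  exact/bounded_measurable_integrable/bounded_measurable_indic.
rewrite -RintegralD//; [|exact: bounded_measurable_integrable..].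
apply: le_Rintegral => //; apply: bounded_measurable_integrable.
  exact: bounded_measurable_norm.
exact: bounded_measurableD.
Qed.

End BoundedMeasurable.

Section SignedIntegral.
Context {d} {T : measurableType d} {R : realType}.
Variables p n : {finite_measure set T -> \bar R}.
Implicit Types f g : T -> R.

Definition signed_integral f : R := \int[p]_x f x - \int[n]_x f x.
Local Notation I := signed_integral.

Definition total_mass (A : set T) : R := fine (p A) + fine (n A).

Lemma total_mass_ge0 A : 0 <= total_mass A.
Proof. by rewrite addr_ge0// fine_ge0. Qed.

Lemma total_mass_le A B : measurable A -> measurable B -> A `<=` B ->
  total_mass A <= total_mass B.
Proof.
move=> mA mB AB; apply: lerD; apply: fine_le;
  rewrite ?fin_num_measure//; by apply: le_measure; rewrite ?inE.
Qed.

Lemma signed_integralD f g : bounded_measurable f -> bounded_measurable g ->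
  I (fun x => f x + g x) = I f + I g.
Proof.
move=> bf bg; rewrite /I !RintegralD//; try exact: bounded_measurable_integrable.
by ring.
Qed.

Lemma signed_integralZ r f : bounded_measurable f ->
  I (fun x => r * f x) = r * I f.
Proof.
move=> bf; rewrite /I !RintegralZl//; try exact: bounded_measurable_integrable.
by ring.
Qed.

Lemma signed_integral_sum (J : finType) (f : J -> T -> R) :
  (forall i, bounded_measurable (f i)) ->
  I (fun x => \sum_i f i x) = \sum_i I (f i).
Proof.
move=> bf; elim: (index_enum J) => [|i s IH].
  rewrite big_nil (_ : (fun _ => _) = fun=> 0 * 0).
    by rewrite (signed_integralZ 0) ?mul0r//; exact: bounded_measurable_cst.
  by apply/funext => x; rewrite big_nil mul0r.
rewrite big_cons -IH -signed_integralD//; last exact: bounded_measurable_sum.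
congr I.
by apply/funext => x; rewrite big_cons.
Qed.

Lemma signed_integral_le_tail f (e M : R) (A : set T) : bounded_measurable f ->
  measurable A -> (forall x, `|f x| <= e + M * \1_A x) ->
  `|I f| <= e * total_mass setT + M * total_mass A.
Proof.
move=> bf mA fe; apply: le_trans (ler_normB _ _) _.
have := Rintegral_le_tail p bf mA fe; have := Rintegral_le_tail n bf mA fe.
by rewrite /total_mass; lra.
Qed.

Lemma signed_integral_le f (e : R) : bounded_measurable f ->
  (forall x, `|f x| <= e) -> `|I f| <= e * total_mass setT.
Proof.
move=> bf fe; rewrite -[leRHS]addr0 -(mul0r (total_mass set0)).
by apply: signed_integral_le_tail => // x; rewrite mul0r addr0.
Qed.

Section Step.
Context {J : finType} (A : J -> set T) (U : set T).
Hypothesis mA : forall i, measurable (A i).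
Hypothesis mU : measurable U.
Hypothesis AU : forall x, \sum_i \1_(A i) x = \1_U x :> R.

(** The difference splits into the oscillation of [f] on the blocks and the part of [f] off [U]. The
    weights [I \1_(A i)] do not depend on [f], so one partition serves several functions. *)
Lemma signed_integral_step f (v : J -> R) (e M : R) : 0 <= e ->
  bounded_measurable f -> (forall x, `|f x| <= M) ->
  (forall i x, A i x -> `|f x - v i| <= e) ->
  `|I f - \sum_i I \1_(A i) * v i| <=
  e * total_mass setT + M * total_mass (~` U).
Proof.
move=> e0 bf fM fv.
have bv i : bounded_measurable (fun x => v i * \1_(A i) x).
  exact/bounded_measurableZ/bounded_measurable_indic.
have -> : \sum_i I \1_(A i) * v i = I (fun x => \sum_i v i * \1_(A i) x).
  rewrite signed_integral_sum//; apply: eq_bigr => i _.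
  by rewrite signed_integralZ 1?mulrC//; exact: bounded_measurable_indic.
have bs := bounded_measurable_sum (index_enum J) bv.
rewrite -mulN1r -signed_integralZ// -signed_integralD//; last first.
  exact: bounded_measurableZ.
apply: signed_integral_le_tail => [||x].
- exact/bounded_measurableD/bounded_measurableZ.
- exact: measurableC.
have -> : f x + -1 * (\sum_i v i * \1_(A i) x) =
    \sum_i (f x - v i) * \1_(A i) x + f x * (1 - \1_U x).
  under [in RHS]eq_bigr do rewrite mulrBl.
  by rewrite sumrB -mulr_sumr AU; ring.
apply: le_trans (ler_normD _ _) _; apply: lerD.
  apply: le_trans (ler_norm_sum _ _ _) _.
  apply: (@le_trans _ _ (\sum_i e * \1_(A i) x)).
    apply: ler_sum => i _; rewrite indicE; have [/set_mem Aix|_] := boolP (x \in A i).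
      by rewrite !mulr1; exact: fv.
    by rewrite !mulr0 normr0.
  by rewrite -mulr_sumr AU indicE; case: (_ \in _); rewrite ?mulr1 ?mulr0.
rewrite !indicE in_setC; case: (_ \in _) => /=.
  by rewrite subrr !mulr0 normr0.
by rewrite subr0 !mulr1.
Qed.

End Step.

End SignedIntegral.

(** * Borel sets and finite partitions around a compact set *)

Section Borel.
Context {R : realType} {X : topologicalType} (x0 : X).
Local Notation T := (borel x0).

Lemma open_borel (U : set X) : open U -> measurable (U : set T).
Proof. by move=> oU; apply: sub_sigma_algebra. Qed.

Lemma closed_borel (U : set X) : closed U -> measurable (U : set T).
Proof.
by move=> /closed_openC/open_borel/measurableC; rewrite setCK.
Qed.

Lemma continuous_borel (f : X -> R) : continuous f ->
  measurable_fun setT (f : T -> R).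
Proof.
move=> /continuousP cf; apply: (measurability _ (RGenOpens.measurableE R)).
move=> _ [_ [a [b ->] <-]]; rewrite setTI; apply: open_borel.
exact/cf/interval_open.
Qed.

(** One identity of indicators encodes disjointness and covering, in the form used by
    [signed_integral_step]. Two partitions are glued by removing [U1] from the blocks of the
    second. *)
Lemma compact_partition (C : set X) (O : X -> set X) : compact C ->
  (forall x, nbhs x (O x)) ->
  exists (J : finType) (x : J -> X) (A : J -> set T) (U : set T),
  [/\ forall i, measurable (A i), measurable U, C `<=` U,
    forall y, \sum_i \1_(A i) y = \1_U y :> R & forall i, A i `<=` O (x i)].
Proof.
move=> cC Onear.
apply: (@compact_ind X C (fun V => exists (J : finType) (x : J -> X)
  (A : J -> set T) (U : set T),
  [/\ forall i, measurable (A i), measurable U, V `<=` U,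
    forall y, \sum_i \1_(A i) y = \1_U y :> R & forall i, A i `<=` O (x i)])) => //.
- exists void, (fun _ => x0), (fun=> set0), set0; split => // y.
  by rewrite indic0 big1// => -[].
- move=> V W VW [J [x [A [U [mA mU WU AU AO]]]]].
  by exists J, x, A, U; split => //; exact: subset_trans WU.
- move=> V1 V2 [J1 [x1 [A1 [U1 [mA1 mU1 VU1 AU1 AO1]]]]].
  move=> [J2 [x2 [A2 [U2 [mA2 mU2 VU2 AU2 AO2]]]]].
  exists (J1 + J2)%type,
    (fun i => match i with inl i => x1 i | inr i => x2 i end),
    (fun i => match i with inl i => A1 i | inr i => A2 i `\` U1 end),
    (U1 `|` U2); split => [[i|i]|||y|[i|i]].
  + exact: mA1.
  + exact: measurableD.
  + exact: measurableU.
  + exact: setUSS.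
  + rewrite big_sumType /= AU1.
    have -> : \sum_i \1_(A2 i `\` U1) y = \sum_i (1 - \1_U1 y) * \1_(A2 i) y :> R.
      apply: eq_bigr => i _; rewrite setDE indicI/= mulrC; congr (_ * _).
      by rewrite !indicE in_setC; case: (_ \in _); rewrite ?subrr ?subr0.
    rewrite -mulr_sumr AU2 !indicE in_setU.
    by case: (y \in U1); case: (y \in U2) => /=; rewrite ?subrr ?subr0; ring.
  + exact: AO1.
  + by apply: subset_trans (AO2 i) => y [].
- move=> x _; exists (O x)^°; first exact/nbhs_interior.
  exists unit, (fun=> x), (fun=> (O x)^°), (O x)^°.
  split=> // [i||y|i]; try by apply: open_borel; exact: open_interior.
  + by rewrite sumr_const card_unit mulr1n.
  + exact: interior_subset.
Qed.

End Borel.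

(** * The energy bound for dominated functions *)

Section DominatedIntegral.
Context {R : realType} {X : topologicalType} (x0 : X).
Local Notation T := (borel x0).
Variables p n : {finite_measure set T -> \bar R}.
Local Notation I := (signed_integral p n).

Definition tight : Prop := forall e : R, 0 < e ->
  exists C : set X, [/\ compact C, measurable (C : set T)
    & total_mass p n (~` (C : set T)) <= e].

(** Continuity of [x] to [K x] in the uniform norm. *)
Definition equicontinuous_kernel (K : X -> X -> R) : Prop :=
  forall x e, 0 < e -> nbhs x [set y | forall z, `|K y z - K x z| <= e].

Hypothesis pn_tight : tight.
Variables (K : X -> X -> R) (B : R).
Hypothesis Ksym : forall x y, K x y = K y x.
Hypothesis KB : forall x y, `|K x y| <= B.
Hypothesis Kequi : equicontinuous_kernel K.

Lemma bounded_measurable_kernel y : bounded_measurable (K^~ y : T -> R).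
Proof.
split; last by exists B.
apply: continuous_borel => x; apply/cvgrPdist_le => e e0.
by apply: filterS (Kequi x e0) => z /(_ y); rewrite distrC.
Qed.

Lemma potential_le x y e : (forall z, `|K y z - K x z| <= e) ->
  `|I (K^~ y) - I (K^~ x)| <= e * total_mass p n setT.
Proof.
move=> H.
rewrite -mulN1r -signed_integralZ -?signed_integralD; try exact: bounded_measurable_kernel.
  apply: signed_integral_le => [|z]; last by rewrite mulN1r Ksym [K z x]Ksym.
  apply: bounded_measurableD; first exact: bounded_measurable_kernel.
  exact/bounded_measurableZ/bounded_measurable_kernel.
exact/bounded_measurableZ/bounded_measurable_kernel.
Qed.

Lemma bounded_measurable_potential :
  bounded_measurable ((fun y => I (K^~ y)) : T -> R).
Proof.
split; last first.
  exists (B * total_mass p n setT) => y.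
  by apply: signed_integral_le => //; exact: bounded_measurable_kernel.
apply: continuous_borel => x; apply/cvgrPdist_le => e e0.
have V0 : 0 < total_mass p n setT + 1 by rewrite ltr_pwDr// total_mass_ge0.
apply: filterS (Kequi x (divr_gt0 e0 V0)) => z Hz; rewrite distrC.
apply: le_trans (potential_le Hz) _; rewrite mulrAC ler_pdivrMr//.
by rewrite ler_wpM2l ?ltW// ltrDl.
Qed.

(* A tight signed measure is approximated by finite combinations of point
   masses simultaneously on [g], on [K] and on the potential of [K]. *)
Lemma dominated_integral s (g : X -> R) : 0 <= s -> continuous g ->
  (forall x, `|g x| <= B) -> dominated s K g ->
  I g ^+ 2 <= s * I (fun y => I (K^~ y)).
Proof.
move=> s0 gc gB Kg.
set V := total_mass p n setT.
have V0 : 0 <= V by exact: total_mass_ge0.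
have B0 : 0 <= B by exact: le_trans (normr_ge0 _) (KB x0 x0).
have bg : bounded_measurable (g : T -> R).
  by split; [exact: continuous_borel|exists B].
have bJ := bounded_measurable_potential.
set J := fun y => I (K^~ y) in bJ *.
(* [S] and [Q] are the integral of [g] and the energy for point masses [c i] at [x i]. Domination
   relates them exactly, and both errors are linear in [h]. *)
have approx h : 0 < h -> exists S Q, [/\ `|I g - S| <= h * (V + B),
    `|I J - Q| <= h * (2 * V * (V + B)) & S ^+ 2 <= s * Q].
  move=> h0; have [C [cC mC tC]] := pn_tight h0.
  have near_g x : nbhs x [set y | `|g y - g x| <= h /\
      forall z, `|K y z - K x z| <= h].
    apply: filterS2 (Kequi x h0) => [y|]; first by move=> gy Ky; split; [exact: gy|].
    move/cvgrPdist_le : (gc x) => /(_ h h0); apply: filterS => y.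
    by rewrite distrC.
  have [F [x [A [U [mA mU CU AU AO]]]]] := compact_partition (R := R) x0 cC near_g.
  have tU : total_mass p n (~` U) <= h.
    apply: le_trans tC; apply: total_mass_le; try exact: measurableC.
    exact: subsetC.
  have tU0 := total_mass_ge0 p n (~` U).
  pose c i := I \1_(A i).
  exists (\sum_i c i * g (x i)), (quad (fun i j => K (x i) (x j)) c); split.
  - apply: le_trans (signed_integral_step p n mA mU AU
      (v := fun i => g (x i)) (ltW h0) bg gB _) _.
      by move=> i y /AO[].
    by rewrite -/V [leRHS]mulrDr lerD// [leRHS]mulrC ler_wpM2l.
  (* The outer and the inner integral are discretised in turn. *)
  - have -> : I J - quad (fun i j => K (x i) (x j)) c =
        (I J - \sum_i c i * J (x i)) -
        (0 - \sum_i c i * (J (x i) - \sum_j c j * K (x j) (x i))).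
      have -> : \sum_i c i * (J (x i) - \sum_j c j * K (x j) (x i)) =
          \sum_i c i * J (x i) - quad (fun i j => K (x i) (x j)) c.
        rewrite -sumrB; apply: eq_bigr => i _; rewrite mulrBr mulr_sumr.
        by congr (_ - _); apply: eq_bigr => j _; rewrite mulrA Ksym.
      by ring.
    have h1 : `|I J - \sum_i c i * J (x i)| <= h * V * V + B * V * h.
      apply: le_trans (signed_integral_step p n mA mU AU
        (v := fun i => J (x i)) (e := h * V) (M := B * V) _ bJ _ _) _.
      + by rewrite mulr_ge0// ltW.
      + by move=> y; apply: signed_integral_le => //; exact: bounded_measurable_kernel.
      + by move=> i y /AO[_ /potential_le].
      + by rewrite lerD// ler_wpM2l ?mulr_ge0.
    have h2 i : `|J (x i) - \sum_j c j * K (x j) (x i)| <= h * V + B * h.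
      apply: le_trans (signed_integral_step p n mA mU AU (v := fun j => K (x j) (x i))
        (ltW h0) (bounded_measurable_kernel (x i)) _ _) _.
      + by move=> y; exact: KB.
      + by move=> j y /AO[_]; exact.
      + by rewrite lerD// ler_wpM2l.
    (* The weighted sum of the inner errors is read as a step approximation of the zero function,
       which bounds it by their maximal size times the total mass. *)
    have h3 : `|0 - \sum_i c i * (J (x i) - \sum_j c j * K (x j) (x i))|
        <= (h * V + B * h) * V + 0 * h.
      have I0 : 0 = I (fun=> 0 * 0).
        by rewrite signed_integralZ ?mul0r//; exact: bounded_measurable_cst.
      rewrite [X in `|X - _|]I0.
      apply: le_trans (signed_integral_step p n mA mU AU
        (v := fun i => J (x i) - \sum_j c j * K (x j) (x i))
        (e := h * V + B * h) (M := 0) _ _ _ _) _.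
      + by rewrite addr_ge0// mulr_ge0// ltW.
      + exact: bounded_measurable_cst.
      + by move=> y; rewrite mul0r normr0.
      + by move=> i y _; rewrite mul0r sub0r normrN.
      + by rewrite lerD// !mul0r.
    apply: le_trans (ler_normB _ _) _; apply: le_trans (lerD h1 h3) _.
    by rewrite le_eqVlt; apply/orP; left; apply/eqP; ring.
  - exact: Kg.
apply/ler_addgt0Pr => e e0.
(* The coefficient of [h] in the errors [k1] and [k2] below, for [h <= 1]; the final 1 keeps it
   positive. *)
pose M := s * (2 * V * (V + B)) + (V + B) * (2 * `|I g| + (V + B)) + 1.
have VB0 : 0 <= V + B by exact: addr_ge0.
have M0 : 0 < M.
  rewrite ltr_pwDr// addr_ge0// mulr_ge0//.
    by rewrite mulr_ge0// mulr_ge0.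
  by rewrite addr_ge0// mulr_ge0.
pose h := Num.min 1 (e / M).
have h0 : 0 < h by rewrite lt_min ltr01 divr_gt0.
have h1 : h <= 1 by rewrite ge_min lexx.
have hM : h * M <= e by rewrite -ler_pdivlMr// ge_min lexx orbT.
have [S [Q [gS JQ SQ]]] := approx h h0.
have -> : I g ^+ 2 = S ^+ 2 + (I g - S) * (2 * I g - (I g - S)) by ring.
have k1 : (I g - S) * (2 * I g - (I g - S)) <= h * ((V + B) * (2 * `|I g| + (V + B))).
  apply: le_trans (ler_norm _) _; rewrite normrM mulrA ler_pM//.
  apply: le_trans (ler_normB _ _) _; rewrite normrM ger0_norm// lerD//.
  by apply: le_trans gS _; rewrite ler_piMl.
have k2 : s * Q <= s * I J + h * (s * (2 * V * (V + B))).
  have := ler_wpM2l s0 JQ; have := ler_wpM2l s0 (ler_norm (Q - I J)).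
  rewrite distrC; lra.
by move: hM; rewrite /M; lra.
Qed.

End DominatedIntegral.

(** * Vanishing of signed measures *)

(** For positive definite [K] this increment is the squared RKHS distance between the sections at
    [x] and [y]. *)
Lemma kernel_increment_near {R : realType} {X : topologicalType}
    (K : X -> X -> R) (x : X) (e : R) :
  continuous (fun p : X * X => K p.1 p.2) -> 0 < e ->
  \forall y \near x, K y y - 2 * K x y + K x x <= e.
Proof.
move=> Kc e0; pose q y := K y y - 2 * K x y + K x x.
have qc : {for x, continuous q}.
  have diag : {for x, continuous (fun y => K y y)}.
    apply: (@continuous_comp _ _ _ (fun y => (y, y)) (fun p => K p.1 p.2)).
      by apply: cvg_pair; exact: cvg_id.
    exact: Kc.
  have sect : {for x, continuous (K x)}.
    apply: (@continuous_comp _ _ _ (fun y => (x, y)) (fun p => K p.1 p.2)).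
      by apply: cvg_pair; [exact: cvg_cst|exact: cvg_id].
    exact: Kc.
  apply: cvgD; last exact: cvg_cst.
  by apply: cvgB; [exact: diag|apply: cvgMl_tmp; exact: sect].
move/cvgrPdist_le : qc => /(_ _ e0); apply: filterS => y.
rewrite (_ : q x = 0) ?sub0r ?normrN; last by rewrite /q; ring.
exact: le_trans (ler_norm _).
Qed.

(** Cauchy-Schwarz against the section at [z] bounds the squared difference by [K z z * q y],
    uniformly in [z] because the diagonal is at most [B]. *)
Lemma psd_equicontinuous {R : realType} {X : topologicalType} (K : X -> X -> R) (B : R) :
  continuous (fun p : X * X => K p.1 p.2) -> 0 < B ->
  (forall x, K x x <= B) -> (forall x y, K x y = K y x) ->
  (forall (I : finType) (x : I -> X) c, 0 <= quad (fun i j => K (x i) (x j)) c) ->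
  equicontinuous_kernel K.
Proof.
move=> Kc B0 KB Ksym Kpsd x e e0.
pose q y := K y y - 2 * K x y + K x x.
have Kq y z : (K y z - K x z) ^+ 2 <= K z z * q y.
  have := dominated_section z Ksym Kpsd (fun b : bool => if b then y else x)
    (fun b => if b then 1 else -1).
  rewrite /quad !big_bool /= (Ksym y x).
  by congr (_ <= _); [congr (_ ^+ 2)|]; rewrite /q; ring.
have e2 : 0 < e ^+ 2 / B by rewrite divr_gt0// exprn_gt0.
apply: filterS (kernel_increment_near x Kc e2) => y qy z.
have e_ge0 := ltW e0.
rewrite -ler_sqr ?nnegrE// real_normK ?num_real//.
apply: le_trans (Kq y z) _.
rewrite -[leRHS](divfK (lt0r_neq0 B0)) [leRHS]mulrC ler_pM//.
- by have := psd_diag_ge0 tt (Kpsd unit (fun=> z)).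
- have := Kpsd bool (fun b : bool => if b then y else x)
    (fun b => if b then 1 else -1).
  rewrite /quad !big_bool /= (Ksym y x).
  by congr (_ <= _); rewrite /q; ring.
Qed.

Section Vanishing.
Context {R : realType} {X : topologicalType} (x0 : X).
Local Notation T := (borel x0).

Lemma null_of_integral (m : {finite_measure set T -> \bar R}) (w : T -> R)
    (A : set T) : bounded_measurable w -> (forall x, 0 < w x) -> measurable A ->
  \int[m]_x (w x * \1_A x) = 0 -> m A = 0%E.
Proof.
move=> bw w0 mA.
have bwA : bounded_measurable (fun x => w x * \1_A x).
  exact/bounded_measurableM/bounded_measurable_indic.
have iw := bounded_measurable_integrable m bwA.
rewrite /Rintegral => /eqP; rewrite fine_eq0 ?integrable_fin_num// => /eqP i0.
have : (\int[m]_x `|(w x * \1_A x)%:E| = 0)%E.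
  rewrite -[RHS]i0; apply: eq_integral => x _; rewrite gee0_abs// lee_fin.
  by rewrite indicE mulr_ge0 ?ler0n ?ltW.
move=> /(ae_eq_integral_abs m measurableT (measurable_int m iw)) [N [mN mN0 AN]].
apply/eqP; rewrite eq_le measure_ge0 andbT -mN0 le_measure ?inE//.
move=> x Ax; apply: AN => /= /(_ I) /eqP; rewrite indicE mem_set// mulr1 eqe.
by rewrite gt_eqF.
Qed.

Variables p n : {finite_measure set T -> \bar R}.
Local Notation I := (signed_integral p n).
Variables (w : X -> R) (F : (X -> R) -> Prop) (P N : set T).
Hypotheses (wc : continuous w) (w0 : forall x, 0 < w x) (w1 : forall x, w x <= 1).
Hypotheses (F1 : F (fun=> 1))
  (FD : forall f g, F f -> F g -> F (fun x => f x + g x))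
  (FZ : forall r f, F f -> F (fun x => r * f x))
  (Fc : forall f, F f -> continuous f)
  (Fsep : forall x y, x <> y -> exists2 f, F f & f x <> f y).
Hypothesis Fw : forall f, F f -> I (fun x => w x * cos (f x)) = 0.

Let bw : bounded_measurable (w : T -> R).
Proof.
split; first exact: continuous_borel.
by exists 1 => x; rewrite gtr0_norm.
Qed.

Let bwb b : cos_closure F b -> bounded_measurable (fun x : T => w x * b x).
Proof.
move=> Fb; apply: bounded_measurableM => //; split.
  by apply: continuous_borel; exact: (cos_closure_continuous Fc).
by have [M _ bM] := cos_closure_bounded Fb; exists M.
Qed.

Lemma cos_closure_annihilated b : cos_closure F b -> I (fun x => w x * b x) = 0.
Proof.
elim=> {b} [f Ff|a b Fa Ia Fb Ib|r a Fa Ia|u a Fu Iu ua].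
- exact: Fw.
- have := signed_integralD p n (bwb Fa) (bwb Fb); rewrite Ia Ib addr0 => <-.
  by congr I; apply/funext => x; rewrite mulrDr.
- have := signed_integralZ p n r (bwb Fa); rewrite Ia mulr0 => <-.
  by congr I; apply/funext => x; rewrite mulrCA.
- have Fa := cos_closure_lim Fu ua.
  have V0 : 0 < total_mass p n setT + 1 by rewrite ltr_pwDr// total_mass_ge0.
  apply/eqP; rewrite -normr_le0; apply/ler_addgt0Pr => e e0; rewrite add0r.
  have [k ke] := exists_invS_lt (divr_gt0 e0 V0).
  have -> : I (fun x => w x * a x) = I (fun x => w x * a x + -1 * (w x * u k x)).
    rewrite signed_integralD ?signed_integralZ ?Iu ?mulr0 ?addr0//; try exact: bwb.
    exact/bounded_measurableZ/bwb.
  apply: le_trans (signed_integral_le _ _ (e := e / (total_mass p n setT + 1)) _ _) _.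
  + exact/bounded_measurableD/bounded_measurableZ/bwb/Fu/bwb.
  + move=> x; rewrite mulN1r -mulrBr normrM gtr0_norm//.
    apply: le_trans (ltW ke); apply: le_trans (ua k x).
    by rewrite ler_piMl.
  + by rewrite mulrAC ler_pdivrMr// ler_wpM2l ?ltW// ltrDl.
Qed.

Hypotheses (mP : measurable P) (mN : measurable N).
Hypotheses (pN : p N = 0%E) (nP : n P = 0%E)
  (PN : P `|` N = setT) (PN0 : P `&` N = set0).
Hypothesis regular : forall (E : set T) (e : R), measurable E -> 0 < e ->
  exists C : set X, [/\ compact C, measurable (C : set T), C `<=` E
    & total_mass p n (E `\` C) <= e].

(* The sign function [\1_P - \1_N] of the signed measure [p - n] is
   approximated by an element of the closure that is 1 on a large compact
   part of [P] and -1 on a large compact part of [N]. *)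
Lemma signed_measure_eq0 : p setT = 0%E /\ n setT = 0%E.
Proof.
pose h x : R := \1_P x + -1 * \1_N x.
have bh : bounded_measurable (h : T -> R).
  apply: bounded_measurableD; first exact: bounded_measurable_indic.
  exact/bounded_measurableZ/bounded_measurable_indic.
have bwh : bounded_measurable (fun x : T => w x * h x).
  exact: bounded_measurableM.
have Iwh : I (fun x => w x * h x) = 0.
  apply/eqP; rewrite -normr_le0; apply/ler_addgt0Pr => e e0; rewrite add0r.
  (* The integrand below is at most 2 on a set of mass at most e / 4 + e / 4, and 0 elsewhere. *)
  have e4 : 0 < e / 4 by rewrite divr_gt0.
  have [C [cC mC CP tC]] := regular mP e4.
  have [D [cD mD DN tD]] := regular mN e4.
  have CD : C `&` D = set0.
    by rewrite -subset0 -PN0 => x [/CP Px /DN Nx].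
  have [b [Fb b1 bC bD]] := cos_closure_separates F1 FD FZ Fc Fsep cC cD CD.
  have -> : I (fun x => w x * h x) = I (fun x => w x * h x + -1 * (w x * b x)).
    rewrite signed_integralD ?signed_integralZ ?(cos_closure_annihilated Fb)
      ?mulr0 ?addr0//; try exact: bwb.
    exact/bounded_measurableZ/bwb.
  have bd : bounded_measurable (fun x : T => w x * h x + -1 * (w x * b x)).
    exact/bounded_measurableD/bounded_measurableZ/bwb.
  pose A := (P `\` C) `|` (N `\` D).
  have mA : measurable A by apply: measurableU; exact: measurableD.
  have h2 x : `|w x * h x + -1 * (w x * b x)| <= 0 + 2 * \1_A x.
    have h1 : `|h x| <= 1.
      rewrite /h !indicE; case: (boolP (x \in P)) => [/set_mem Px|_].
        rewrite memNset ?mulr0 ?addr0 ?normr1// => Nx.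
        by have : (P `&` N) x by []; rewrite PN0.
      by case: (x \in N); rewrite /= ?mulr0 ?addr0 ?normr0// mulr1 add0r normrN1.
    rewrite mulN1r -mulrBr normrM gtr0_norm// add0r indicE.
    have [/set_mem Ax|nA] := boolP (x \in A).
      rewrite mulr1 -[leRHS]mul1r ler_pM ?(ltW (w0 x))//.
      apply: le_trans (ler_normB _ _) _.
      exact: (@lerD _ _ 1 _ 1).
    rewrite mulr0; suff -> : h x = b x by rewrite subrr normr0 mulr0.
    have {}nA : ~ A x by move=> /mem_set; exact/negP.
    have : (P `|` N) x by rewrite PN.
    rewrite /h !indicE => -[Px|Nx].
      have Cx : C x by apply: contrapT => nC; apply: nA; left.
      rewrite mem_set// memNset ?mulr0 ?addr0 ?bC// => Nx.
      by have : (P `&` N) x by []; rewrite PN0.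
    have Dx : D x by apply: contrapT => nD; apply: nA; right.
    rewrite memNset ?mem_set ?mulr1 ?add0r ?bD// => Px.
    by have : (P `&` N) x by []; rewrite PN0.
  apply: le_trans (signed_integral_le_tail p n bd mA h2) _; rewrite mul0r add0r.
  have tA : total_mass p n A <= total_mass p n (P `\` C) + total_mass p n (N `\` D).
    have U2 (m : {finite_measure set T -> \bar R}) :
        fine (m A) <= fine (m (P `\` C)) + fine (m (N `\` D)).
      rewrite -fineD ?fin_num_measure//; try exact: measurableD.
      rewrite fine_le ?fin_numD ?fin_num_measure//; try exact: measurableD.
      by apply/measureU2; exact: measurableD.
    by rewrite /total_mass; have := U2 p; have := U2 n; lra.
  by lra.
have bwi A : measurable A -> bounded_measurable (fun x : T => w x * \1_A x).
  by move=> mA; exact/bounded_measurableM/bounded_measurable_indic.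
have null (m : {finite_measure set T -> \bar R}) (A : set T) : measurable A ->
    m A = 0%E -> \int[m]_x (w x * \1_A x) = 0.
  move=> mA mA0; apply/eqP; rewrite -normr_le0.
  have := @Rintegral_le_tail _ _ _ m _ 0 1 A (bwi A mA) mA.
  rewrite mA0 /= mul0r mulr0 addr0; apply => x.
  rewrite add0r mul1r indicE; case: (x \in A).
    by rewrite mulr1 gtr0_norm.
  by rewrite mulr0 normr0.
have split_int (m : {finite_measure set T -> \bar R}) : \int[m]_x (w x * h x) =
    \int[m]_x (w x * \1_P x) + -1 * \int[m]_x (w x * \1_N x).
  rewrite -RintegralZl//; last exact/bounded_measurable_integrable/bwi.
  rewrite -RintegralD//.
  - by apply: eq_Rintegral => x _; rewrite /h; ring.
  - exact/bounded_measurable_integrable/bwi.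
  - exact/bounded_measurable_integrable/bounded_measurableZ/bwi.
have ge0 (m : {finite_measure set T -> \bar R}) (A : set T) :
    0 <= \int[m]_x (w x * \1_A x).
  by apply: Rintegral_ge0 => x _; rewrite indicE mulr_ge0 ?ler0n ?ltW.
(* What remains is the [p]-integral of w over [P] plus the [n]-integral of w over [N]. Both are
   nonnegative, hence zero. *)
move: Iwh; rewrite /signed_integral !split_int (null p N)// (null n P)//.
move=> E; have := ge0 p P; have := ge0 n N => h1 h2.
have total (m : {finite_measure set T -> \bar R}) :
    m P = 0%E -> m N = 0%E -> m setT = 0%E.
  move=> mP0 mN0; apply/eqP; rewrite eq_le measure_ge0 andbT -PN.
  have -> : 0%E = (m P + m N)%E by rewrite mP0 mN0 adde0.
  exact: measureU2.
split; apply: total => //; apply: null_of_integral bw w0 _ _ => //; lra.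
Qed.

End Vanishing.

(** * Charges, variation and regularity *)

Section ChargeIntegral.
Context {d} {T : measurableType d} {R : realType}.
Implicit Types (nu : {charge set T -> \bar R}) (f : T -> R).

Lemma jordan_pos_measurable nu P N (h : hahn_decomposition nu P N) (A : set T) :
  measurable A -> jordan_pos h A = nu (A `&` P).
Proof. by move=> mA; rewrite jordan_posE cjordan_posE /crestr0 mem_set. Qed.

Lemma jordan_neg_measurable nu P N (h : hahn_decomposition nu P N) (A : set T) :
  measurable A -> jordan_neg h A = (- nu (A `&` N))%E.
Proof. by move=> mA; rewrite jordan_negE cjordan_negE /crestr0 mem_set. Qed.

(** Lets each later argument bring its own Hahn decomposition, such as a swapped or an explicit
    one. *)
Lemma charge_integralE nu f P N (h : hahn_decomposition nu P N) :
  charge_integral nu f = signed_integral (jordan_pos h) (jordan_neg h) f.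
Proof.
rewrite /charge_integral.
move: (projT2 (cid (projT2 (cid (Hahn_decomposition nu))))) => /= h'.
rewrite /signed_integral /Rintegral; have U := Hahn_decomposition_uniq h' h.
congr (fine _ - fine _); apply: eq_measure_integral => A mA _.
  by rewrite [LHS]jordan_pos_measurable// [RHS]jordan_pos_measurable//; have [] := U A mA.
rewrite [LHS]jordan_neg_measurable// [RHS]jordan_neg_measurable//.
by have [_ ->] := U A mA.
Qed.

Lemma hahn_decomposition_opp nu P N :
  hahn_decomposition nu P N -> hahn_decomposition (copp nu) N P.
Proof.
move=> [[mP hP] [mN hN] PN PN0]; split; [split=> // A mA AN|split=> // A mA AP|..].
- by rewrite /copp /= oppe_ge0; exact: hN.
- by rewrite /copp /= oppe_le0; exact: hP.
- by rewrite setUC.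
- by rewrite setIC.
Qed.

Lemma charge_integral_opp nu f : charge_integral (copp nu) f = - charge_integral nu f.
Proof.
have [P [N h]] := Hahn_decomposition nu.
rewrite (charge_integralE f h) (charge_integralE f (hahn_decomposition_opp h)).
rewrite /signed_integral opprB /Rintegral.
congr (fine _ - fine _); apply: eq_measure_integral => A mA _.
  by rewrite [LHS]jordan_pos_measurable// [RHS]jordan_neg_measurable.
by rewrite [LHS]jordan_neg_measurable// [RHS]jordan_pos_measurable// oppeK.
Qed.

Lemma charge_integral0 nu : charge_integral nu (fun=> 0) = 0.
Proof.
by rewrite /charge_integral /Rintegral !integral0 subrr.
Qed.

(** For a real kernel the cross terms of [cm_re] and [cm_im] fall into the imaginary part, and
    conjugation makes the sign of the second square positive. *)
Lemma cm_conj_integral_real (l : complex_measure T R) (K : T -> T -> R) :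
  cm_integral (cm_conj l) (fun y => cm_integral l (fun x => (K x y)%:C)) = 0 ->
  charge_integral (cm_re l) (fun y => charge_integral (cm_re l) (K^~ y))
  + charge_integral (cm_im l) (fun y => charge_integral (cm_im l) (K^~ y)) = 0.
Proof.
move=> /(congr1 (@complex.Re R)); rewrite /cm_integral /= charge_integral_opp opprK.
move=> H; rewrite -[RHS]H; congr (_ + _); congr charge_integral.
  by apply/funext => y; rewrite charge_integral0 subr0.
by apply/funext => y; rewrite charge_integral0 add0r.
Qed.

End ChargeIntegral.

Section Variation.
Import ComplexField.Normc.
Context {d} {T : measurableType d} {R : realType} (l : complex_measure T R).

Lemma normc_nonneg (z : R[i]) : 0 <= normc z.
Proof. by case: z => a b /=; exact: sqrtr_ge0. Qed.

(** A partition of [C], preceded by [B] and by the rest of [E], is a partition of [E]. *)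
Lemma cm_variation_superadd (E C B : set T) : measurable E -> measurable C ->
  measurable B -> C `<=` E -> B `<=` E -> C `&` B = set0 ->
  (cm_variation l C + (normc (cm_val l B))%:E <= cm_variation l E)%E.
Proof.
move=> mE mC mB CE BE CB; rewrite -leeBrDr//; apply: ge_ereal_sup => _ [A [mA tA AC] <-].
rewrite leeBrDr// addeC.
pose A' k := if k is k'.+1 then (if k' is k''.+1 then A k'' else E `\` (C `|` B)) else B.
have AC' k : A k `<=` C by rewrite -AC; exact: bigcup_sup.
apply: (@le_trans _ _ (\sum_(0 <= k <oo) (normc (cm_val l (A' k)))%:E)%E).
  have A'0 k : (0 <= (normc (cm_val l (A' k)))%:E)%E by rewrite lee_fin normc_nonneg.
  rewrite [leRHS](@nneseries_split _ _ 0 2)// add0n -(nneseries_addn 2 A'0).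
  rewrite big_nat_recr//= big_nat1 -addeA leeD2l//.
  under [X in (_ <= _ + X)%E]eq_eseriesr do rewrite addn2.
  exact: leeDr.
apply: ereal_sup_ubound; exists A' => //; split.
- by move=> [|[|k]] //=; apply: measurableD => //; exact: measurableU.
- apply/trivIsetP => -[|[|i]] [|[|j]] _ _ //= ij.
  + by rewrite -subset0 => x [Bx [_]]; apply; right.
  + by rewrite -subset0 -CB => x [Bx /AC'].
  + by rewrite -subset0 => x [[_ +] Bx]; apply; right.
  + by rewrite -subset0 => x [[_ +] /AC' Cx]; apply; left.
  + by rewrite -subset0 -CB => x [/AC'].
  + by rewrite -subset0 => x [/AC' Cx [_]]; apply; left.
  + by have /trivIsetP := tA; apply.
- apply/seteqP; split => [x [[|[|k]] _ /=]|x Ex].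
  + exact: BE.
  + by case.
  + by move=> /AC'; exact: CE.
  + have [Bx|nB] := pselect (B x); first by exists 0%N.
    have [Cx|nC] := pselect (C x); last by exists 1%N => //=; split=> // -[].
    by move: Cx; rewrite -AC => -[k _ Akx]; exists k.+2.
Qed.

Lemma cm_variation_ge (E B : set T) : measurable E -> measurable B -> B `<=` E ->
  ((normc (cm_val l B))%:E <= cm_variation l E)%E.
Proof.
move=> mE mB BE.
have := cm_variation_superadd mE measurable0 mB (@sub0set _ _) BE (set0I _).
apply: le_trans; rewrite leeDr//.
apply: (@le_trans _ _ (\sum_(0 <= k <oo) (normc (cm_val l (set0 : set T)))%:E)%E).
  by apply: nneseries_ge0 => k _ _; rewrite lee_fin normc_nonneg.
apply: ereal_sup_ubound; exists (fun=> set0) => //; split => //.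
  exact: trivIset_set0.
exact: bigcup0.
Qed.

End Variation.

Section Radon.
Import ComplexField.Normc.
Context {R : realType} {X : topologicalType} (x0 : X).
Local Notation T := (borel x0).
Hypothesis hX : hausdorff_space X.

Lemma compact_borel (C : set X) : compact C -> measurable (C : set T).
Proof. by move=> /(compact_closed hX); exact: closed_borel. Qed.

(** Inner regularity gives [C] with nearly the full variation of [E]; by [cm_variation_superadd]
    only [e] is left for any [B] outside [C]. Bounding values of [l] lets the estimate pass to its
    real and imaginary parts. *)
Lemma radon_regular (l : complex_measure T R) (E : set T) (e : R) : radon l ->
  measurable E -> 0 < e ->
  exists C : set X, [/\ compact C, measurable (C : set T), C `<=` E &
    forall B : set T, measurable B -> B `<=` E `\` C -> normc (cm_val l B) <= e].
Proof.
move=> [fin reg] mE e0; have [inner _] := reg E mE.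
have Efin : cm_variation l E \is a fin_num.
  rewrite ge0_fin_numE.
    apply: le_lt_trans fin.
    have := cm_variation_superadd l measurableT mE measurable0 (@subsetT _ E)
      (@sub0set _ _) (setI0 E).
    by apply: le_trans; rewrite leeDl// lee_fin normc_nonneg.
  apply: le_trans (cm_variation_ge l mE measurable0 (@sub0set _ _)).
  by rewrite lee_fin normc_nonneg.
rewrite inner in Efin; have [_ [C [cC CE] <-]] := ub_ereal_sup_adherent e0 Efin.
rewrite -inner in Efin *; move=> lt.
have mC := compact_borel cC; exists C; split => // B mB BE.
have := cm_variation_superadd l mE mC mB CE
  (subset_trans BE (@subDsetl _ _ _)) _.
have -> : C `&` B = set0 by rewrite -subset0 => x [Cx /BE[]].
move=> /(_ erefl) H; rewrite -lee_fin.
move: lt; rewrite -(fineK Efin); move: H; rewrite -(fineK Efin).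
case: (cm_variation l C) => [r||] //=.
rewrite -EFinD !lee_fin -EFinB lte_fin; lra.
Qed.

(** Each half of the Hahn decomposition contributes at most [e]. *)
Lemma charge_regular (nu : {charge set T -> \bar R}) P N
    (h : hahn_decomposition nu P N) (E C : set T) (e : R) :
  measurable E -> measurable C ->
  (forall B : set T, measurable B -> B `<=` E `\` C -> `|fine (nu B)| <= e) ->
  total_mass (jordan_pos h) (jordan_neg h) (E `\` C) <= 2 * e.
Proof.
move=> mE mC H; have mEC : measurable (E `\` C) by exact: measurableD.
have [[mP _] [mN _] _ _] := h.
have -> : total_mass (jordan_pos h) (jordan_neg h) (E `\` C) =
    fine (nu ((E `\` C) `&` P)) + - fine (nu ((E `\` C) `&` N)).
  rewrite -fineN; congr (fine _ + fine _); first exact: jordan_pos_measurable.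
  exact: jordan_neg_measurable.
have := H _ (measurableI _ _ mEC mP) (@subIsetl _ _ _).
have := H _ (measurableI _ _ mEC mN) (@subIsetl _ _ _).
rewrite !ler_norml => /andP[h1 _] /andP[_ h2]; lra.
Qed.

End Radon.

(** * The kernel [1 / L] *)

Section InverseKernelCharge.
Context {R : realType} {X : topologicalType} (x0 : X).
Local Notation T := (borel x0).
Variable (L : X -> X -> R).
Hypotheses (Lcont : continuous (fun p : X * X => L p.1 p.2))
  (Llog : log_conditional L).
Local Notation K := (inverse_kernel L).
Local Notation g := (log_kernel L).

Let L_ge1 x y : 1 <= L x y. Proof. by case: Llog. Qed.
Let L_gt0 x y : 0 < L x y. Proof. exact: lt_le_trans ltr01 (L_ge1 x y). Qed.
Let L_sym x y : L x y = L y x. Proof. by case: Llog. Qed.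
Let g_cnd : cond_neg_def g. Proof. by case: Llog. Qed.

Lemma inverse_kernel_sym x y : K x y = K y x.
Proof. by rewrite /inverse_kernel L_sym. Qed.

Lemma inverse_kernel_gt0 x y : 0 < K x y.
Proof. by rewrite invr_gt0. Qed.

Lemma inverse_kernel_le1 x y : K x y <= 1.
Proof. by rewrite invf_le1. Qed.

Lemma inverse_kernel_norm_le1 x y : `|K x y| <= 1.
Proof. by rewrite gtr0_norm ?inverse_kernel_le1// inverse_kernel_gt0. Qed.

Lemma inverse_kernel_continuous : continuous (fun p : X * X => K p.1 p.2).
Proof.
by move=> p; apply: cvgV; [rewrite gt_eqF|exact: Lcont].
Qed.

(** Domination of w cos(1) already contains the positivity. A point of the family serves as base
    point, so the empty family is treated apart. *)
Lemma inverse_kernel_psd (I : finType) (x : I -> X) c :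
  0 <= quad (fun i j => K (x i) (x j)) c.
Proof.
have [i _|I0] := pickP (@predT I); last first.
  by rewrite /quad big1// => i; have := I0 i.
have := inverse_kernel_dominated Llog (x0 := x i) ltr01 (based_kernel_cst _ g_cnd).
by apply: dominated_psd; rewrite !divr_gt0 ?expR_gt0.
Qed.

Lemma inverse_kernel_equicontinuous : equicontinuous_kernel K.
Proof.
apply: psd_equicontinuous inverse_kernel_continuous ltr01 _ inverse_kernel_sym _.
  by move=> x; exact: inverse_kernel_le1.
exact: inverse_kernel_psd.
Qed.

Variable nu : {charge set T -> \bar R}.
Hypothesis nu_regular : forall (E : set T) (e : R), measurable E -> 0 < e ->
  exists C : set X, [/\ compact C, measurable (C : set T), C `<=` E &
    forall B : set T, measurable B -> B `<=` E `\` C -> `|fine (nu B)| <= e].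

Local Notation energy :=
  (charge_integral nu (fun y => charge_integral nu (fun x => K x y))).

Lemma energyE P N (h : hahn_decomposition nu P N) :
  energy = signed_integral (jordan_pos h) (jordan_neg h)
    (fun y => signed_integral (jordan_pos h) (jordan_neg h) (K^~ y)).
Proof.
rewrite (charge_integralE _ h); congr signed_integral.
by apply/funext => y; rewrite (charge_integralE _ h).
Qed.

Lemma jordan_regular P N (h : hahn_decomposition nu P N) (E : set T) (e : R) :
  measurable E -> 0 < e ->
  exists C : set X, [/\ compact C, measurable (C : set T), C `<=` E
    & total_mass (jordan_pos h) (jordan_neg h) (E `\` C) <= e].
Proof.
move=> mE e0; have e2 : 0 < e / 2 by rewrite divr_gt0.
have [C [cC mC CE HC]] := nu_regular mE e2.
exists C; split => //; apply: le_trans (charge_regular h mE mC HC) _; lra.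
Qed.

Lemma jordan_tight P N (h : hahn_decomposition nu P N) :
  tight (jordan_pos h) (jordan_neg h).
Proof.
move=> e e0; have [C [cC mC _ HC]] := jordan_regular h measurableT e0.
by exists C; split => //; rewrite -setTD.
Qed.

(** [dominated_integral] applied to the zero function. *)
Lemma energy_ge0 : 0 <= energy.
Proof.
have [P [N h]] := Hahn_decomposition nu.
rewrite (energyE h) -[leRHS]mul1r.
have h0 : dominated 1 K (fun=> 0).
  move=> I x c; rewrite mul1r big1 ?expr0n ?inverse_kernel_psd//.
  by move=> i _; rewrite mulr0.
have := dominated_integral (jordan_tight h) inverse_kernel_sym inverse_kernel_norm_le1
  inverse_kernel_equicontinuous ler01 (@cst_continuous _ _ 0) _ h0.
by move=> H; apply: le_trans (sqr_ge0 _) (H _) => x; rewrite normr0.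
Qed.

Lemma energy_eq0 : log_metrizable L -> energy = 0 ->
  forall A, measurable A -> nu A = 0%E.
Proof.
move=> Lmet E0; have [P [N h]] := Hahn_decomposition nu.
have [[mP _] [mN _] PN PN0] := h; rewrite (energyE h) in E0.
pose F f := continuous f /\ exists2 s, 0 < s & dominated s (based_kernel g x0) f.
have section_continuous z : continuous (L^~ z).
  move=> x; apply: (@continuous_comp _ _ _ (fun y => (y, z)) (fun p => L p.1 p.2)).
    by apply: cvg_pair; [exact: cvg_id|exact: cvg_cst].
  exact: Lcont.
have gc z : continuous (g^~ z).
  move=> x; apply: (@continuous_comp _ _ _ (L^~ z) (@ln R)).
    exact: section_continuous.
  exact: continuous_ln.
have gs := based_kernel_cst x0 g_cnd.
have F1 : F (fun=> 1).
  by split; [exact: cst_continuous|exists 1].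
have FD f1 f2 : F f1 -> F f2 -> F (fun x => f1 x + f2 x).
  move=> [c1 [s s0 d1]] [c2 [t t0 d2]]; split.
    by move=> x; exact: (continuousD (c1 x) (c2 x)).
  by exists (2 * (s + t)); [rewrite mulr_gt0// addr_gt0|exact: dominatedD].
have FZ r f : F f -> F (fun x => r * f x).
  move=> [fc [s s0 d]]; split.
    by move=> x; exact: (continuousM (@cst_continuous _ _ r x) (fc x)).
  exists (r ^+ 2 * s + 1).
    by rewrite ltr_wpDl// mulr_ge0 ?sqr_ge0 ?ltW.
  move=> I x c; apply: le_trans (dominatedZ r d x c) _.
  by rewrite ler_wpM2r ?lerDl//; exact: dominated_psd ltr01 gs.
have Fc f : F f -> continuous f by case.
have Fk z : F ((based_kernel g x0)^~ z).
  split.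
    move=> x; apply: cvgD; first exact: cvg_cst.
    apply: cvgB; last exact: cvg_cst.
    apply: cvgB; last exact: gc.
    by apply: cvgD; [exact: gc|exact: cvg_cst].
  exists (based_kernel g x0 z z + 1); last exact: based_kernel_section.
  rewrite ltr_wpDl//; have := dominated_psd (fun=> z) (fun=> 1) ltr01 gs.
  by move=> /(_ unit); rewrite /quad !big_const card_unit /= !mul1r !addr0.
(* If neither section, at [x] or at [y], separates the two points, adding the equalities [e1] and
   [e2] gives 2 g(x,y) = g(x,x) + g(y,y), against metrizability. *)
have Fsep x y : x <> y -> exists2 f, F f & f x <> f y.
  move=> xy; have g_sym := proj1 g_cnd.
  have [e1|] := eqVneq (based_kernel g x0 x x) (based_kernel g x0 y x); last first.
    by move=> /eqP ?; exists ((based_kernel g x0)^~ x).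
  have [e2|] := eqVneq (based_kernel g x0 x y) (based_kernel g x0 y y); last first.
    by move=> /eqP ?; exists ((based_kernel g x0)^~ y).
  have := Lmet x y xy; move: e1 e2; rewrite /based_kernel (g_sym y x); lra.
have w0 x : 0 < (L x x0)^-1 by rewrite invr_gt0.
have w1 x : (L x x0)^-1 <= 1 by rewrite invf_le1.
have wc : continuous (fun x => (L x x0)^-1).
  by move=> x; apply: cvgV; [rewrite gt_eqF|exact: section_continuous].
have Fw f : F f -> signed_integral (jordan_pos h) (jordan_neg h)
    (fun x => (L x x0)^-1 * cos (f x)) = 0.
  move=> [fc [s s0 /(inverse_kernel_dominated Llog s0) d]].
  have := dominated_integral (jordan_tight h) inverse_kernel_sym inverse_kernel_norm_le1
    inverse_kernel_equicontinuous _ _ _ d.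
  rewrite E0 mulr0 => H; apply/eqP; rewrite -sqrf_eq0 eq_le sqr_ge0 andbT.
  apply: H => [|x|x].
  - by rewrite !divr_ge0 ?expR_ge0 ?ltW.
  - apply: cvgM; first exact: wc.
    by apply: continuous_comp; [exact: fc|exact: continuous_cos].
  - rewrite normrM gtr0_norm// -[leRHS]mul1r ler_pM//; first exact: ltW.
    by rewrite ler_norml cos_geN1 cos_le1.
have pN : jordan_pos h N = 0%E.
  by rewrite jordan_pos_measurable// setIC PN0 charge0.
have nP : jordan_neg h P = 0%E.
  by rewrite jordan_neg_measurable// PN0 charge0 oppe0.
have [pT nT] := signed_measure_eq0 wc w0 w1 F1 FD FZ Fc Fsep Fw mP mN pN nP PN PN0
  (jordan_regular h).
move=> A mA; rewrite (jordan_decomp h mA) /cadd /= cscaleN1.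
have null (m : {measure set T -> \bar R}) : m setT = 0%E -> m A = 0%E.
  by move=> m0; apply/eqP; rewrite eq_le measure_ge0 andbT -m0 le_measure ?inE.
by rewrite [X in (X + _)%E](null _ pT) [X in (- X)%E](null _ nT) sube0.
Qed.

End InverseKernelCharge.

(** * Complex positivity and reproducing kernel Hilbert spaces *)

Lemma sum_complex {R : realType} {I : finType} (u v : I -> R) :
  \sum_i (u i +i* v i) = (\sum_i u i) +i* (\sum_i v i).
Proof.
elim: (index_enum I) => [|i s IH]; first by rewrite !big_nil.
by rewrite !big_cons IH.
Qed.

(** The imaginary parts are antisymmetric in [i] and [j], so they cancel once the sums are
    exchanged. *)
Lemma complex_quad {R : realType} {I : finType} (A : I -> I -> R) (c : I -> R[i]) :
  (forall i j, A i j = A j i) ->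
  \sum_i \sum_j c i * (c j)^* * (A i j)%:C =
  (quad A (fun i => complex.Re (c i)) + quad A (fun i => complex.Im (c i)))%:C.
Proof.
move=> Asym.
pose u i j := complex.Re (c i) * complex.Re (c j) * A i j +
  complex.Im (c i) * complex.Im (c j) * A i j.
pose v i j := complex.Im (c i) * complex.Re (c j) * A i j -
  complex.Re (c i) * complex.Im (c j) * A i j.
have E i j : c i * (c j)^* * (A i j)%:C = u i j +i* v i j.
  rewrite /u /v; case: (c i) => a b; case: (c j) => a' b' /=.
  by apply/eqP; rewrite eq_complex /=; apply/andP; split; apply/eqP; ring.
under eq_bigr do under eq_bigr do rewrite E.
under eq_bigr do rewrite sum_complex.
rewrite sum_complex; apply/eqP; rewrite eq_complex /=; apply/andP; split; apply/eqP.
  by rewrite /quad -big_split; apply: eq_bigr => i _; rewrite -big_split.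
rewrite /v; under eq_bigr do rewrite sumrB.
rewrite sumrB [X in _ - X]exchange_big /= -sumrB big1// => i _.
by rewrite -sumrB big1// => j _; rewrite Asym; ring.
Qed.

Lemma real_kernel_pos_def {R : realType} {X : Type} (K : X -> X -> R) :
  (forall x y, K x y = K y x) ->
  (forall (I : finType) (x : I -> X) c, 0 <= quad (fun i j => K (x i) (x j)) c) ->
  pos_def (fun x y => (K x y)%:C).
Proof.
move=> Ksym Kpsd n x c _.
rewrite (complex_quad c (fun i j => Ksym (x i) (x j))) lecE /= eqxx /=.
exact: addr_ge0.
Qed.

Section Rkhs.
Context {R : realType} {X : Type} {K : X -> X -> R[i]} (H : rkhs K).
Local Notation ip := (rkhs_ip H).
Local Notation fun_in := (rkhs_fun H).

Lemma rkhs_ip_lincomb a F G : fun_in F -> fun_in G ->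
  ip (a *: G + F) (a *: G + F) =
  a * a^* * ip G G + (a * (ip F G)^* + a^* * ip F G) + ip F F.
Proof.
move=> HF HG; have HGF := rkhs_lincomb a HG HF.
rewrite rkhs_ip_linear// (rkhs_ip_conj HGF HG) (rkhs_ip_conj HGF HF).
rewrite !rkhs_ip_linear// (rkhs_ip_conj HF HG).
rewrite !rmorphD !rmorphM /= !conjCK -(rkhs_ip_conj HG HG) -(rkhs_ip_conj HF HF).
by ring.
Qed.

(* Cauchy-Schwarz for the real and the imaginary part separately: test
   positivity of [t G + F] and [t i G + F] for real [t]. *)
Lemma rkhs_cauchy_schwarz F G : fun_in F -> fun_in G ->
  complex.Re (ip F G) ^+ 2 <= complex.Re (ip G G) * complex.Re (ip F F) /\
  complex.Im (ip F G) ^+ 2 <= complex.Re (ip G G) * complex.Re (ip F F).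
Proof.
move=> HF HG.
have ge0 E : fun_in E -> 0 <= complex.Re (ip E E).
  by move=> /rkhs_ip_ge0; rewrite lecE => /andP[].
have lin a : 0 <= complex.Re (a * a^* * ip G G + (a * (ip F G)^* + a^* * ip F G) + ip F F).
  by rewrite -rkhs_ip_lincomb//; apply: ge0; exact: rkhs_lincomb.
have imG : complex.Im (ip G G) = 0.
  by have := rkhs_ip_ge0 HG; rewrite lecE => /andP[/eqP].
split; (apply: sqr_le_of_quadratic => [|t]; first exact: ge0).
  have := lin (t +i* 0); move: imG.
  case: (ip F G) => a b; case: (ip G G) => c d; case: (ip F F) => e f /= ->.
  by congr (_ <= _); ring.
have := lin (0 +i* t); move: imG.
case: (ip F G) => a b; case: (ip G G) => c d; case: (ip F F) => e f /= ->.
by congr (_ <= _); ring.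
Qed.

End Rkhs.

Lemma normc_le_sum {R : rcfType} (z : R[i]) :
  ComplexField.Normc.normc z <= `|complex.Re z| + `|complex.Im z|.
Proof.
case: z => a b /=; rewrite -ler_sqr ?nnegrE ?sqrtr_ge0 ?addr_ge0//.
rewrite sqr_sqrtr ?addr_ge0 ?sqr_ge0//.
by rewrite sqrrD !real_normK ?num_real// addrAC lerDl mulrn_wge0 ?mulr_ge0.
Qed.

(** F(y) - F(x) is the inner product of F with the difference [Gy y] of two sections, whose squared
    norm is the increment of [kernel_increment_near]. *)
Lemma real_kernel_rkhs_continuous {R : realType} {X : topologicalType} (K : X -> X -> R) :
  continuous (fun p : X * X => K p.1 p.2) -> (forall x y, K x y = K y x) ->
  rkhs_continuous (fun x y => (K x y)%:C).
Proof.
move=> Kc Ksym H F HF x; apply/cvgrPdist_le => e.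
rewrite ltcE /= => /andP[/eqP e_im e0].
set r := complex.Re e in e0.
have eE : e = r%:C by apply/eqP; rewrite eq_complex /= e_im !eqxx.
pose Gy y : X -> R[i] := (-1) *: (fun z => (K z x)%:C) + (fun z => (K z y)%:C).
have HG y : rkhs_fun H (Gy y) by apply: rkhs_lincomb; exact: rkhs_kernel.
have ipG E y : rkhs_fun H E -> rkhs_ip H E (Gy y) = E y - E x.
  move=> HE; rewrite (rkhs_ip_conj (HG y) HE) rkhs_ip_linear//; try exact: rkhs_kernel.
  rewrite (rkhs_ip_conj HE (rkhs_kernel H x)) (rkhs_ip_conj HE (rkhs_kernel H y)).
  rewrite !rkhs_reproducing// rmorphD rmorphM rmorphN rmorph1 /= !conjCK.
  by rewrite mulN1r addrC.
have GG y : complex.Re (rkhs_ip H (Gy y) (Gy y)) = K y y - 2 * K x y + K x x.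
  rewrite ipG// /Gy !fctE /= (Ksym y x).
  by rewrite !mulN1r /=; ring.
set p := complex.Re (rkhs_ip H F F).
have p0 : 0 <= p by have := rkhs_ip_ge0 HF; rewrite lecE => /andP[].
(* Chosen so that Cauchy-Schwarz bounds the real and the imaginary part by [r / 2] each; [p + 1]
   avoids dividing by zero. *)
have d0 : 0 < (r / 2) ^+ 2 / (p + 1).
  by rewrite divr_gt0 ?exprn_gt0 ?divr_gt0// ltr_wpDl.
apply: filterS (kernel_increment_near x Kc d0) => y qy.
have [] := rkhs_cauchy_schwarz HF (HG y); rewrite GG ipG// -/p.
set q := (_ - _ + _) in qy *.
have bound (s : R) : s ^+ 2 <= q * p -> `|s| <= r / 2.
  move=> sq; rewrite -ler_sqr ?nnegrE//; last by rewrite divr_ge0// ltW.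
  rewrite real_normK ?num_real//; apply: le_trans sq _.
  apply: (@le_trans _ _ ((r / 2) ^+ 2 / (p + 1) * p)); first exact: ler_wpM2r.
  rewrite mulrAC ler_pdivrMr ?ltr_wpDl//.
  by rewrite ler_wpM2l ?sqr_ge0// lerDl.
move=> /bound bRe /bound bIm.
rewrite distrC eE; apply: (@le_trans _ _ (ComplexField.Normc.normc (F y - F x))%:C).
  exact: lexx.
rewrite lecR; apply: le_trans (normc_le_sum _) _.
by rewrite (le_trans (lerD bRe bIm))// -splitr.
Qed.

(** * Combinations of two Dirac masses *)

Section TwoPointCharge.
Import ComplexField.Normc.
Context {R : realType} {X : topologicalType} (x0 : X).
Local Notation T := (borel x0).
Hypothesis hX : hausdorff_space X.
Variables (x y : X) (a b : R).

Definition point_charge (z : X) : {charge set T -> \bar R} :=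
  charge_of_finite_measure (\d_(z : T) : {finite_measure set T -> \bar R}).

Definition two_point_charge : {charge set T -> \bar R} :=
  cadd (cscale a (point_charge x)) (cscale b (point_charge y)).

Definition two_point_measure : complex_measure T R :=
  ComplexMeasure two_point_charge (czero : {charge set T -> \bar R}).

Lemma two_point_chargeE (A : set T) :
  two_point_charge A = (a * \1_A x + b * \1_A y)%:E.
Proof. by []. Qed.

Lemma two_point_measureE (A : set T) :
  cm_val two_point_measure A = (a * \1_A x + b * \1_A y)%:C.
Proof. by []. Qed.

Hypothesis xy : x <> y.

Let mset1 (z : X) : measurable ([set z] : set T).
Proof. by apply: compact_borel => //; exact: compact_set1. Qed.

(** The upper bound is the triangle inequality with countable additivity of Dirac masses; the lower
    bound splits [E] into its parts at [x] and away from [x]. *)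
Lemma two_point_variation (E : set T) : measurable E ->
  cm_variation two_point_measure E = (`|a| * \1_E x + `|b| * \1_E y)%:E.
Proof.
move=> mE; have normE A : normc (cm_val two_point_measure A) = `|a * \1_A x + b * \1_A y|.
  by rewrite two_point_measureE /= expr0n /= addr0 sqrtr_sqr.
apply/eqP; rewrite eq_le; apply/andP; split.
  apply: ge_ereal_sup => _ [A [mA tA AE] <-].
  pose m (z : X) (r : R) (A : set T) := (r%:E * \d_(z : T) A)%E.
  have sum_m z r : 0 <= r -> (\sum_(0 <= n <oo) m z r (A n) = m z r E)%E.
    move=> r0; rewrite nneseriesZl//; congr (_ * _)%E.
    have mAU : measurable (\bigcup_n A n) by rewrite AE.
    rewrite -AE; apply: (cvg_lim (@ereal_hausdorff R)).
    exact: (measure_semi_sigma_additive A mA tA mAU).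
  have -> : (`|a| * \1_E x + `|b| * \1_E y)%:E = (m x `|a|%R E + m y `|b|%R E)%E by [].
  rewrite -!sum_m// -nneseriesD; last 2 first.
  - by move=> n _ _; rewrite mule_ge0.
  - by move=> n _ _; rewrite mule_ge0.
  apply: lee_nneseries => n *; rewrite lee_fin normE//.
  apply: le_trans (ler_normD _ _) _; rewrite !normrM.
  by rewrite (ger0_norm (x := \1_(A n) x)) ?(ger0_norm (x := \1_(A n) y))// indicE ler0n.
have mEx : measurable (E `&` [set x] : set T) by exact: measurableI.
have mED : measurable (E `\` [set x] : set T) by exact: measurableD.
have D0 : (E `\` [set x]) `&` (E `&` [set x]) = set0.
  by rewrite -subset0 => z [[_ +] [_]].
apply: le_trans (cm_variation_superadd two_point_measure
  mE mED mEx (@subDsetl _ _ _) (@subIsetl _ _ _) D0).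
have := @cm_variation_ge _ _ _ two_point_measure _ _ mED mED (@subset_refl _ _).
move=> /(leeD2r (normc (cm_val two_point_measure (E `&` [set x])))%:E); apply: le_trans.
rewrite !normE -EFinD lee_fin !indicE setDE !in_setI !in_setC !in_set1 eqxx.
have -> : (y == x) = false by apply/eqP => yx; apply: xy.
rewrite /= !andbF !andbT !mulr0 add0r addr0.
by case: (x \in E); case: (y \in E); rewrite ?mulr1 ?mulr0 ?normr0 ?addr0 ?add0r// addrC.
Qed.

(** Both extrema are attained: at the points of [E] among [x], [y], and at the complement of those
    outside [E], open because finite sets are closed. *)
Lemma two_point_radon : radon two_point_measure.
Proof.
split; first by rewrite two_point_variation// ltry.
move=> E mE.
have compact_fin (A : set X) : A `<=` [set x; y] -> compact A.
  move=> Axy; apply: finite_compact; apply: sub_finite_set Axy _.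
  exact: finite_set2.
have var_eq (A B : set T) : measurable A -> measurable B ->
    (A x <-> B x) -> (A y <-> B y) ->
    cm_variation two_point_measure A = cm_variation two_point_measure B.
  move=> mA mB Ax Ay; rewrite !two_point_variation// !indicE.
  have mem_eq z : (A z <-> B z) -> (z \in A) = (z \in B).
    by move=> H; apply/idP/idP => /set_mem/H/mem_set.
  by rewrite (mem_eq x Ax) (mem_eq y Ay).
have var_le (A B : set T) : measurable A -> measurable B -> A `<=` B ->
    (cm_variation two_point_measure A <= cm_variation two_point_measure B)%E.
  move=> mA mB AB; rewrite !two_point_variation// lee_fin !indicE.
  have le1 z : ((z \in A)%:R <= (z \in B)%:R :> R).
    by have [/set_mem/AB/mem_set ->//|_] := boolP (z \in A); rewrite ler0n.
  by apply: lerD; rewrite ler_wpM2l.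
split; apply/eqP; rewrite eq_le; apply/andP; split.
- have cC : compact (E `&` [set x; y]) by apply: compact_fin; exact: subIsetr.
  apply: ereal_sup_ubound; exists (E `&` [set x; y]); first by split=> // z [].
  apply: var_eq => //; first exact: compact_borel.
    by split=> [[]|Ex] //; split=> //; left.
  by split=> [[]|Ey] //; split=> //; right.
- apply: ge_ereal_sup => _ [C [cC CE] <-].
  by apply: var_le => //; exact: compact_borel.
- apply: le_ereal_inf_tmp => _ [U [oU EU] <-].
  by apply: var_le => //; exact: open_borel.
- have cC : compact ([set x; y] `\` E) by apply: compact_fin; exact: subDsetl.
  have oU : open (~` ([set x; y] `\` E)).
    by apply: closed_openC; exact: compact_closed.
  apply: ereal_inf_lbound; exists (~` ([set x; y] `\` E)).
    by split=> // z Ez [].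
  apply: var_eq => //; first exact: open_borel.
    split=> [nx|Ex [_]//]; apply: contrapT => nEx; apply: nx; split=> //; by left.
  split=> [ny|Ey [_]//]; apply: contrapT => nEy; apply: ny; split=> //; by right.
Qed.

Lemma Rintegral_concentrated (m : {finite_measure set T -> \bar R}) (f : T -> R) z :
  bounded_measurable f -> m (~` [set z]) = 0%E ->
  \int[m]_u f u = f z * fine (m setT).
Proof.
move=> bf mz; have [_ [M fM]] := bf.
have bd : bounded_measurable (fun u => f u + - f z).
  exact/bounded_measurableD/bounded_measurable_cst.
have mC : measurable (~` [set z] : set T) by apply: measurableC; exact: mset1.
have H u : `|f u + - f z| <= 0 + (2 * M) * \1_(~` [set z]) u.
  rewrite add0r indicE in_setC in_set1; have [->|uz] := eqVneq u z.
    by rewrite subrr normr0 mulr0.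
  rewrite mulr1 mulrDl mul1r; apply: le_trans (ler_normB _ _) _; exact: lerD.
have := Rintegral_le_tail m bd mC H.
rewrite mul0r add0r mz mulr0 normr_le0 => /eqP.
rewrite RintegralD//; try exact: bounded_measurable_integrable.
  by rewrite Rintegral_cst// mulNr => /eqP; rewrite subr_eq0 => /eqP.
exact/bounded_measurable_integrable/bounded_measurable_cst.
Qed.

Hypotheses (a0 : 0 <= a) (b0 : b <= 0).

(** The signs of [a] and [b] make this decomposition explicit, so integrals can be evaluated. *)
Lemma two_point_hahn : hahn_decomposition two_point_charge [set x] (~` [set x]).
Proof.
split.
- split=> // A mA Ax; rewrite two_point_chargeE lee_fin !indicE.
  rewrite (memNset (u := y)) ?mulr0 ?addr0; first by rewrite mulr_ge0.
  by move=> /Ax yx; apply: xy.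
- split; first exact: measurableC.
  move=> A mA Ax; rewrite two_point_chargeE lee_fin !indicE.
  rewrite (memNset (u := x)) ?mulr0 ?add0r; first by rewrite mulr_le0_ge0.
  by move=> /Ax; apply.
- exact: setUv.
- exact: setICr.
Qed.

Lemma two_point_integral (f : T -> R) : bounded_measurable f ->
  charge_integral two_point_charge f = a * f x + b * f y.
Proof.
move=> bf; rewrite (charge_integralE f two_point_hahn) /signed_integral.
have yx : (y == x) = false by apply/eqP => yx; apply: xy.
have mC (z : X) : measurable (~` [set z] : set T) by apply: measurableC; exact: mset1.
rewrite (Rintegral_concentrated (z := x))//; last first.
  by rewrite [LHS]jordan_pos_measurable// setICl charge0.
rewrite (Rintegral_concentrated (z := y))//; last first.
  rewrite [LHS]jordan_neg_measurable// two_point_chargeE !indicE !in_setI !in_setC.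
  by rewrite !in_set1 !eqxx /= !andbF /= !mulr0 addr0 oppr0.
have -> : fine (jordan_pos two_point_hahn setT) = a.
  rewrite [X in fine X]jordan_pos_measurable// setTI two_point_chargeE /= !indicE.
  by rewrite !in_set1 eqxx yx mulr1 mulr0 addr0.
have -> : fine (jordan_neg two_point_hahn setT) = - b.
  rewrite [X in fine X]jordan_neg_measurable// setTI two_point_chargeE /= !indicE.
  by rewrite !in_setC !in_set1 eqxx yx mulr1 mulr0 add0r.
by ring.
Qed.

Lemma czero_integral (f : T -> R) : bounded_measurable f ->
  charge_integral (czero : {charge set T -> \bar R}) f = 0.
Proof.
move=> bf.
have h : hahn_decomposition (czero : {charge set T -> \bar R}) setT set0.
  split; [by split|by split|exact: setU0|exact: setI0].
rewrite (charge_integralE f h) /signed_integral.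
rewrite !(Rintegral_concentrated (z := x0))//;
  [|by rewrite [LHS]jordan_neg_measurable ?oppe0//; by apply: measurableC; exact: mset1
   |by rewrite [LHS]jordan_pos_measurable//; by apply: measurableC; exact: mset1].
have -> : fine (jordan_pos h setT) = 0 by rewrite [X in fine X]jordan_pos_measurable.
have -> : fine (jordan_neg h setT) = 0.
  by rewrite [X in fine X]jordan_neg_measurable//= oppr0.
by rewrite mulr0 subrr.
Qed.

Lemma two_point_energy (K : X -> X -> R) :
  (forall z, bounded_measurable (K^~ z : T -> R)) ->
  (forall z, bounded_measurable (K z : T -> R)) ->
  a * (a * K x x + b * K y x) + b * (a * K x y + b * K y y) = 0 ->
  cm_integral (cm_conj two_point_measure)
    (fun z => cm_integral two_point_measure (fun u => (K u z)%:C)) = 0.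
Proof.
move=> bK bK' E0; have b0' := @bounded_measurable_cst _ T R 0.
have inner z : cm_integral two_point_measure (fun u => (K u z)%:C) =
    (a * K x z + b * K y z)%:C.
  by rewrite /cm_integral /= two_point_integral// two_point_integral//
    !czero_integral// !mulr0 !addr0 subr0.
under [X in cm_integral _ X]eq_fun do rewrite inner.
have bKK : bounded_measurable (fun z : T => a * K x z + b * K y z : R).
  by apply: bounded_measurableD; exact: bounded_measurableZ.
rewrite /cm_integral /= !charge_integral_opp !two_point_integral// !czero_integral//.
by rewrite !mulr0 oppr0 !addr0 subr0 E0.
Qed.

End TwoPointCharge.

Theorem theorem6p4 (R : realType) (X : topologicalType) (L : X -> X -> R)
    (hX : hausdorff_space X)
    (Lcont : continuous (fun p : X * X => L p.1 p.2))
    (Llog : log_conditional L) :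
  ispd (fun x y => (inverse_kernel L x y)%:C) <-> log_metrizable L.
Proof.
have Ksym := inverse_kernel_sym Llog.
have Kpsd I x c := @inverse_kernel_psd R X L Llog I x c.
have Kequi := inverse_kernel_equicontinuous Lcont Llog.
have K0 := inverse_kernel_gt0 Llog.
split=> [[_ _ _ K_ispd] x y xy|Lmet]; last first.
  split.
  - by exists 1 => x y; rewrite /= expr0n /= addr0 sqrtr_sqr inverse_kernel_norm_le1.
  - exact: real_kernel_pos_def.
  - exact: real_kernel_rkhs_continuous (inverse_kernel_continuous Lcont Llog) Ksym.
  move=> x0 l l_radon /cm_conj_integral_real E0.
  have regular (nu : {charge set (borel x0) -> \bar R}) :
      (forall B, `|fine (nu B)| <= ComplexField.Normc.normc (cm_val l B)) ->
      forall (E : set (borel x0)) (e : R), measurable E -> 0 < e ->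
      exists C : set X, [/\ compact C, measurable (C : set (borel x0)), C `<=` E &
      forall B : set (borel x0), measurable B -> B `<=` E `\` C -> `|fine (nu B)| <= e].
    move=> nul E e mE e0; have [C [cC mC CE H]] := radon_regular hX l_radon mE e0.
    by exists C; split => // B mB BE; apply: le_trans (nul B) (H B mB BE).
  have norm_re (a b : R) : `|a| <= Num.sqrt (a ^+ 2 + b ^+ 2).
    by rewrite -sqrtr_sqr ler_wsqrtr// lerDl sqr_ge0.
  have norm_im (a b : R) : `|b| <= Num.sqrt (a ^+ 2 + b ^+ 2).
    by rewrite addrC.
  have re_reg := regular (cm_re l) (fun B => norm_re _ _).
  have im_reg := regular (cm_im l) (fun B => norm_im _ _).
  (* Two nonnegative energies with sum 0 both vanish. *)
  have re0 := energy_ge0 Lcont Llog re_reg.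
  have im0 := energy_ge0 Lcont Llog im_reg.
  move=> A mA; rewrite /cm_val.
  rewrite (energy_eq0 Lcont Llog re_reg Lmet _ mA); last by lra.
  by rewrite (energy_eq0 Lcont Llog im_reg Lmet _ mA)//; lra.
rewrite ltNge; apply/negP => nmet.
have [L1 _ _] := Llog.
pose K := inverse_kernel L.
(* Failure of metrizability makes the 2 x 2 determinant at most 0; positive semidefiniteness gives
   the other sign. *)
have KK : K x x * K y y <= K x y ^+ 2.
  have L0 u v : 0 < L u v by exact: lt_le_trans ltr01 (L1 u v).
  rewrite /K /inverse_kernel expr2 -!invfM lef_pV2 ?posrE ?mulr_gt0//.
  rewrite -ler_ln ?posrE ?mulr_gt0// !lnM ?posrE//.
  by move: nmet; rewrite /log_kernel mulr_natl.
have KK' : K x y ^+ 2 <= K x x * K y y.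
  by have := psd_entry_le true false
    (fun i j : bool => Ksym (if i then x else y) (if j then x else y)) (Kpsd _ _).
have {KK KK'} KK : K x y ^+ 2 = K x x * K y y by apply/eqP; rewrite eq_le KK' KK.
have bK z : bounded_measurable (K^~ z : borel x -> R).
  exact: bounded_measurable_kernel (inverse_kernel_norm_le1 Llog) Kequi z.
have bK' z : bounded_measurable (K z : borel x -> R).
  by rewrite (_ : K z = K^~ z)//; apply/funext => u; rewrite /K Ksym.
have Kxx : - K x x <= 0 by rewrite oppr_le0 ltW.
have E0 : K x y * (K x y * K x x + - K x x * K y x) +
    - K x x * (K x y * K x y + - K x x * K y y) = 0.
  have -> : K y x = K x y by exact: Ksym.
  by rewrite -[K x y * K x y]expr2 KK; ring.
(* These coefficients span the kernel of the singular matrix of [K] at [x], [y]. *)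
have rad : radon (two_point_measure x x y (K x y) (- K x x)).
  exact: two_point_radon.
have H := K_ispd x _ rad
  (two_point_energy hX xy (ltW (K0 x y)) Kxx bK bK' E0).
(* The vanishing measure has mass [K x y] at [x], while [K] is strictly positive. *)
have : K x y = 0.
  have : cm_val (two_point_measure x x y (K x y) (- K x x)) [set x] = 0.
    by apply: H; apply: compact_borel => //; exact: compact_set1.
  rewrite two_point_measureE !indicE !in_set1 eqxx.
  have -> : (y == x) = false by apply/eqP => yx; apply: xy.
  by rewrite mulr1 mulr0 addr0 => /(congr1 (@complex.Re R)).
by move=> Kxy; have := K0 x y; rewrite -/K Kxy ltxx.
Qed.
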